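(* Let $\mathfrak g$ be a finite-dimensional real semi-simple Lie algebra, let $n\ge1$, and let $(\mu,\phi)\in L_n(\mathfrak g)$ be a semi-simple pair, i.e. the Lie algebra $\mathfrak h_\mu=(\mathbb R^n,\mu)$ is semi-simple. Then the $GC_n(\mathfrak g)$-orbit of $(\mu,\phi)$ is open in $L_n(\mathfrak g)$.
   Context: $V_n(\mathfrak g)=\mathrm{Lin}(\Lambda^2\mathbb R^n,\mathbb R^n)\oplus \mathrm{Lin}(\mathbb R^n,\mathfrak g)$. $L_n(\mathfrak g)\subseteq V_n(\mathfrak g)$ is the set of pairs $(\mu,\phi)$ such that $\mu$ is a Lie bracket on $\mathbb R^n$ and $\phi:(\mathbb R^n,\mu)\to\mathfrak g$ is a Lie algebra homomorphism; it carries the topology induced by the usual (Euclidean) topology of the finite-dimensional real vector space $V_n(\mathfrak g)$. Let $\mathrm{Inn}(\mathfrak g)$ be the group of inner automorphisms of $\mathfrak g$ (the connected subgroup of $GL(\mathfrak g)$ with Lie algebra $\mathrm{ad}(\mathfrak g)$). The group $GC_n(\mathfrak g)=GL(n,\mathbb R)\times \mathrm{Inn}(\mathfrak g)$ acts on $L_n(\mathfrak g)$ by $(g,h)\cdot(\mu,\phi)=(g\,\mu(g^{-1}\cdot,g^{-1}\cdot),\,h\phi g^{-1})$. *)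

(* Defs.v *)
From HB Require Import structures.
From mathcomp Require Import all_boot all_order all_algebra.
From mathcomp Require Import all_classical all_reals topology.
From mathcomp Require Import normedtype.

Set Implicit Arguments.
Unset Strict Implicit.
Unset Printing Implicit Defensive.

Import Order.TTheory GRing.Theory Num.Theory.
Import numFieldNormedType.Exports.
Import VectorInternalTheory.

Local Open Scope classical_set_scope.
Local Open Scope ring_scope.

(* The usual topology of a finite-dimensional real vector space: the one for
   which the coordinate isomorphism [v2r] with [R^(dim V)] is a homeomorphism. *)
Definition euclidean (R : realType) (V : vectType R) : Type :=
  initial_topology (@v2r R V).

HB.instance Definition _ (R : realType) (V : vectType R) :=
  Uniform.copy (euclidean V) (initial_topology (@v2r R V)).
HB.instance Definition _ (R : realType) (V : vectType R) :=
  isPointed.Build (euclidean V) (0 : V).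

(* [A] is open in [L] for the topology induced on [L] by [V]. *)
Definition open_in (R : realType) (V : vectType R) (L A : set V) : Prop :=
  exists2 U : set (euclidean V), open U & A = L `&` U.

Section LieAlgebra.
Variables (R : realType) (V : vectType R).

(* Bilinear maps are curried linear maps. *)
Implicit Type b : 'Hom(V, 'Hom(V, V)).

Definition alternating b : Prop := forall x, b x x = 0.

Definition jacobi b : Prop :=
  forall x y z, b x (b y z) + b y (b z x) + b z (b x y) = 0.

Definition lie_bracket b : Prop := alternating b /\ jacobi b.

Definition lie_ideal b (I : {vspace V}) : Prop :=
  forall x y, y \in I -> b x y \in I.

Definition derived b (U : {vspace V}) : {vspace V} :=
  <<[seq b u v | u <- vbasis U, v <- vbasis U]>>%VS.

Definition lie_solvable b (U : {vspace V}) : Prop :=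
  exists k, iter k (derived b) U = 0%VS.

(* The radical, i.e. the largest solvable ideal, is zero. *)
Definition semisimple b : Prop :=
  forall I : {vspace V}, lie_ideal b I -> lie_solvable b I -> I = 0%VS.

Definition GL : set 'End(V) := [set f | lker f == 0%VS].

Definition exp_partial (T : 'End(V)) (N : nat) : euclidean 'End(V) :=
  \sum_(k < N) k`!%:R^-1 *: iter k (fun S => (T \o S)%VF) \1%VF.

Definition exp_end (T : 'End(V)) : 'End(V) := lim (exp_partial T @ \oo).

Definition subgroup_of_GL (S : set 'End(V)) : Prop :=
  [/\ S `<=` GL, S \1%VF,
      forall f g, S f -> S g -> S (f \o g)%VF
    & forall f, S f -> S (f^-1)%VF].

(* The connected Lie subgroup of GL(V) with Lie algebra ad(V) is, by
   construction, the subgroup generated by the exponentials exp(ad x);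
   [b x : 'End(V)] is ad x. *)
Definition Inn b : set 'End(V) :=
  smallest subgroup_of_GL [set exp_end (b x) | x in [set: V]].

End LieAlgebra.

Section PairSpace.
Variables (R : realType) (n : nat) (g : vectType R).

(* V_n(g) is the linear subspace of pairs [(mu, phi)] of [pairs n g] with [mu]
   alternating, so both induce the same topology on L_n(g). *)
Definition pairs : vectType R :=
  ('Hom('rV[R]_n, 'Hom('rV[R]_n, 'rV[R]_n)) * 'Hom('rV[R]_n, g))%type.

Definition L_n (b : 'Hom(g, 'Hom(g, g))) : set pairs :=
  [set p : pairs | lie_bracket p.1 /\
           forall x y, p.2 (p.1 x y) = b (p.2 x) (p.2 y)].

Definition transport (a : 'End('rV[R]_n))
    (mu : 'Hom('rV[R]_n, 'Hom('rV[R]_n, 'rV[R]_n))) :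
    'Hom('rV[R]_n, 'Hom('rV[R]_n, 'rV[R]_n)) :=
  linfun (fun x => (a \o mu ((a^-1)%VF x) \o a^-1)%VF).

Lemma transportE a mu x y :
  transport a mu x y = a (mu ((a^-1)%VF x) ((a^-1)%VF y)).
Proof.
pose F x := (a \o mu ((a^-1)%VF x) \o a^-1)%VF.
have F_lin : linear F.
  move=> c u v; apply/lfunP => w; do 3 rewrite !lfunE /=.
  by rewrite !linearP; do 2 rewrite !lfunE /=; rewrite linearP.
pose FL := GRing.isLinear.Build R _ _ _ F F_lin.
pose F' : {linear _ -> _} := HB.pack F FL.
by rewrite /transport -/F (lfunE F') /= !lfunE /= !lfunE.
Qed.

Definition GC_act (a : 'End('rV[R]_n)) (h : 'End(g)) (p : pairs) : pairs :=
  (transport a p.1, (h \o p.2 \o a^-1)%VF).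

Definition GC_orbit (b : 'Hom(g, 'Hom(g, g))) (p : pairs) : set pairs :=
  [set q | exists a h, [/\ GL a, Inn b h & q = GC_act a h p]].

End PairSpace.

(* Main.v *)
From HB Require Import structures.
From mathcomp Require Import all_boot all_order all_algebra.
From mathcomp Require Import complex ring lra zify.
From mathcomp Require Import all_classical all_reals.
From mathcomp Require Import interval_inference topology normedtype sequences exp.
Require Import Defs.

(** The orbit of (mu, phi) contains every point of the variety of pairs close
    to (mu, phi); since a fixed group element acts on pairs by a linear
    bijection, this neighbourhood can be carried to every point of the orbit,
    which is therefore open ([local_orbit] and the theorem itself).

    A pair (mu', phi') close to (mu, phi) is brought back in two steps: a small
    [a] with mu' = exp(a).mu, and then, phi' o exp(a) being a homomorphism
    (R^n, mu) -> g close to phi, a small x with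
    phi' o exp(a) = exp(ad x) o phi.  Both steps are instances of [rigidity].
    There a linear space X acts on Y by operators rho(x), and a subset A of Y
    that is stable under the exp(rho(x)) contains p.  The map
    (x, s) |-> exp(rho(x)) (p + s), with s restricted to a complement S of the
    space of tangent vectors rho(x) p, covers a neighbourhood of p by the
    contraction principle.  If exp(rho(x)) (p + s) lies in A, so does p + s,
    and the equations of A make their linearization at s quadratically small.
    When the linearized equations have no other solutions than the rho(x) p,
    they are injective on S, so |s| <= c |s|^2 and s = 0: the point is
    exp(rho(x)) p.

    What remains is the exactness of the linearized equations.  For brackets
    it is H^2(h, h) = 0 for h = (R^n, mu): contraction with the Casimir element
    of the Killing form, which acts on h as the identity, is a homotopy
    ([casimir_adjoint], [second_whitehead_homotopy]).  For homomorphisms it is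
    H^1(h, g) = 0 ([first_whitehead]): the Casimir element C of the trace form
    of a nontrivial module M has nonzero trace and makes C o d a coboundary
    for every cocycle d, which reduces d to the smaller module where C is
    nilpotent.

    Both use that the trace form of a representation of a semisimple algebra
    is nondegenerate away from the kernel.  This is Cartan's criterion: a
    perfect algebra with vanishing trace form acts by nilpotent operators
    ([commutators_nilpotent]), hence trivially by Engel's theorem
    ([perfect_traceless_trivial]).  Nilpotency is obtained by pairing an
    operator with the polynomial in it that conjugates its eigenvalues.

    Finally exp(S + T) = exp(S) exp(T) for commuting S and T ([expD]) shows
    that exponentials of derivations are automorphisms, and that exponentials
    of the infinitesimal action on brackets are the transports by exp(a)
    ([exp_gl_action]). *)

Set Implicit Arguments.
Unset Strict Implicit.
Unset Printing Implicit Defensive.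

Import Order.TTheory GRing.Theory Num.Theory.
Import numFieldNormedType.Exports.
Import VectorInternalTheory.

Local Open Scope classical_set_scope.
Local Open Scope ring_scope.

(** * Nilpotency of matrices from traces of commutators *)

Section Interpolation.
Variable (F : fieldType).
Implicit Types (p r : {poly F}) (s : seq F).

Lemma coprimep_XsubC_exp (a b : F) m n :
  a != b -> coprimep (('X - a%:P) ^+ m) (('X - b%:P) ^+ n).
Proof.
by move=> ab; apply/coprimep_expl/coprimep_expr; rewrite coprimep_XsubC2 // subr_eq0 eq_sym.
Qed.

(** Prescribes the value at each point of [s] up to order [n], so that
    evaluating [p] at a matrix gives a scalar on each generalized eigenspace
    (Chinese remainder theorem). *)
Lemma hermite_interpolation s n (f : F -> F) :
  exists p, forall a, a \in s -> ('X - a%:P) ^+ n %| p - (f a)%:P.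
Proof.
elim: s => [|a s [p pP]]; first by exists 0.
have [as_|nas] := boolP (a \in s).
  by exists p => b; rewrite inE => /orP[/eqP->|]; apply: pP.
pose w : {poly F} := \prod_(b <- s) ('X - b%:P) ^+ n.
have : coprimep (('X - a%:P) ^+ n) w.
  rewrite /w big_seq; elim/big_rec: _ => [|b q bs cq]; first exact: coprimep1.
  rewrite coprimepMr cq andbT coprimep_XsubC_exp //.
  by apply: contraNneq nas => ->.
case/Bezout_eq1_coprimepP => -[u v] /= uv.
(* v * w is 1 modulo the power of X - a and 0 modulo the others. *)
exists (p + ((f a)%:P - p) * (v * w)) => b; rewrite inE => /orP[/eqP->|bs].
  have -> : p + ((f a)%:P - p) * (v * w) - (f a)%:P
     = (p - (f a)%:P) * u * ('X - a%:P) ^+ n.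
    by rewrite -mulrA -[u * _](addrK (v * w)) uv; ring.
  exact: dvdp_mull.
rewrite addrAC dvdp_add ?pP //; apply/dvdp_mull/dvdp_mull.
by rewrite /w (big_rem b) //= dvdp_mulr.
Qed.

Lemma prod_XsubC_dvd s r :
  (forall a, a \in s -> ('X - a%:P) ^+ size s %| r) ->
  \prod_(a <- s) ('X - a%:P) %| r.
Proof.
move=> sr; rewrite -prodr_undup_exp_count.
have: {subset undup s <= s} by move=> a; rewrite mem_undup.
elim: (undup s) (undup_uniq s) => [|a t IHt] /=; first by rewrite big_nil dvd1p.
case/andP=> nat_ ut ts; rewrite big_cons Gauss_dvdp.
  rewrite IHt // ?andbT => [|b bt]; last by apply: ts; rewrite inE bt orbT.
  apply: dvdp_trans (sr a _); last by rewrite ts ?mem_head.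
  by rewrite dvdp_exp2l // count_size.
rewrite big_seq; elim/big_rec: _ => [|b q bt cq]; first exact: coprimep1.
rewrite coprimepMr cq andbT coprimep_XsubC_exp //.
by apply: contraNneq nat_ => ->.
Qed.

End Interpolation.

Section TrigonalMatrix.
Variables (R : comNzRingType) (n : nat).
Implicit Types A B : 'M[R]_n.+1.

Lemma trig_mxM A B : is_trig_mx A -> is_trig_mx B ->
  is_trig_mx (A *m B) /\ forall i, (A *m B) i i = A i i * B i i.
Proof.
move=> /is_trig_mxP tA /is_trig_mxP tB; split=> [|i].
  apply/is_trig_mxP => i j ij; rewrite mxE big1 // => k _.
  have [ik|ki] := ltnP i k; first by rewrite tA ?mul0r.
  by rewrite tB ?mulr0 // (leq_ltn_trans ki ij).
rewrite mxE (bigD1 i) //= big1 ?addr0 // => k.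
by rewrite -val_eqE /= neq_ltn => /orP[/tB->|/tA->]; rewrite ?mulr0 ?mul0r.
Qed.

Lemma trig_horner_mx A p : is_trig_mx A ->
  is_trig_mx (horner_mx A p) /\ forall i, (horner_mx A p) i i = p.[A i i].
Proof.
move=> tA; elim/poly_ind: p => [|p c [tp pE]].
  by rewrite rmorph0; split=> [|i]; rewrite ?mx0_is_trig // mxE horner0.
have [tpA pAE] := trig_mxM tp tA.
rewrite rmorphD rmorphM /= horner_mx_X horner_mx_C -[_ * A]/(_ *m A); split.
  apply/is_trig_mxP => i j ij; rewrite mxE (elimT is_trig_mxP tpA) // add0r mxE.
  by rewrite -val_eqE /= ltn_eqF.
by move=> i; rewrite mxE pAE pE !hornerE mxE eqxx.
Qed.

End TrigonalMatrix.

Section MatrixAdjoint.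
Variables (C : comNzRingType) (n : nat).
Implicit Types X W : 'M[C]_n.+1.

Definition mxad X W : 'M[C]_n.+1 := X *m W - W *m X.

Fact mxad_is_linear X : linear (mxad X).
Proof.
move=> c u v; rewrite /mxad mulmxDr mulmxDl -scalemxAl -scalemxAr scalerBr.
by rewrite opprD addrACA.
Qed.
HB.instance Definition _ X :=
  GRing.isLinear.Build C 'M_n.+1 'M_n.+1 _ (mxad X) (mxad_is_linear X).
End MatrixAdjoint.

Section TracelessBracket.
Variables (C : numClosedFieldType) (n : nat).
Implicit Types X U V W : 'M[C]_n.+1.

(** On matrices from the generalized eigenspace of b to that of a, ad X is the
    difference of two commuting operators whose eigenvalues are a and b. *)
Lemma mxad_generalized_eigen X W a b s t :
  (X - a%:M) ^+ s *m W = 0 -> W *m (X - b%:M) ^+ t = 0 ->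
  mxvec W *m (lin_mx (mxad X) - (a - b)%:M) ^+ (s + t) = 0.
Proof.
have step V : mxvec V *m (lin_mx (mxad X) - (a - b)%:M)
    = mxvec ((X - a%:M) *m V - V *m (X - b%:M)).
  rewrite mulmxBr mul_vec_lin mul_mx_scalar -linearZ -linearB /=.
  rewrite /mxad mulmxBl mulmxBr mul_scalar_mx mul_mx_scalar scalerBl.
  by rewrite opprD addrACA -opprD.
elim: s t W => [|s IHs] t W.
  by rewrite expr0 mul1mx => -> _; rewrite linear0 mul0mx.
elim: t W => [|t IHt] W; first by rewrite expr0 mulmx1 => _ ->; rewrite linear0 mul0mx.
move=> sW Wt; rewrite addSn exprS mulmxA step linearB mulmxBl IHs.
- rewrite -addSnnS IHt ?subr0 //; first by rewrite mulmxA sW mul0mx.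
  by rewrite -mulmxA -[_ *m _ ^+ _]exprS.
- by rewrite mulmxA -[_ ^+ _ *m _]exprSr.
- by rewrite -mulmxA Wt mulmx0.
Qed.

Lemma horner_generalized_eigen X W a b s t q c :
  (X - a%:M) ^+ s *m W = 0 -> W *m (X - b%:M) ^+ t = 0 ->
  ('X - (a - b)%:P) ^+ (s + t) %| q - c%:P ->
  mxvec W *m horner_mx (lin_mx (mxad X)) q = c *: mxvec W.
Proof.
move=> sW Wt /dvdpP[r qE]; rewrite -[q](subrK c%:P) qE mulrC (rmorphD (horner_mx _)) rmorphM.
rewrite rmorphXn (rmorphB (horner_mx _)) /= horner_mx_X !horner_mx_C mulmxDr mul_mx_scalar.
by rewrite mulmxA mxad_generalized_eigen // mul0mx add0r.
Qed.

(** The polynomial [q] in the operator ad X, applied to W: [lin_mx] turns ad X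
    into a matrix acting on row vectors, on which polynomials are evaluated. *)
Definition mxad_poly X q W : 'M[C]_n.+1 :=
  @vec_mx _ n.+1 n.+1 (mxvec W *m horner_mx (lin_mx (mxad X)) q).

Lemma mxad_poly_generalized_eigen X W a b s t q c :
  (X - a%:M) ^+ s *m W = 0 -> W *m (X - b%:M) ^+ t = 0 ->
  ('X - (a - b)%:P) ^+ (s + t) %| q - c%:P ->
  mxad_poly X q W = c *: W.
Proof.
move=> sW Wt qc; rewrite /mxad_poly (horner_generalized_eigen sW Wt qc).
by rewrite linearZ /= mxvecK.
Qed.

Fact mxad_poly_is_linear X q : linear (mxad_poly X q).
Proof.
by move=> c u v; rewrite /mxad_poly linearP mulmxDl -scalemxAl linearP.
Qed.
HB.instance Definition _ X q :=
  GRing.isLinear.Build C 'M_n.+1 'M_n.+1 _ (mxad_poly X q) (mxad_poly_is_linear X q).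

Lemma mxad_polyMXaddC X q c W :
  mxad_poly X (q * 'X + c%:P) W = mxad_poly X q (mxad X W) + c *: W.
Proof.
rewrite /mxad_poly mulrC (rmorphD (horner_mx _)) rmorphM /=.
rewrite horner_mx_X horner_mx_C mulmxDr mul_mx_scalar linearD linearZ /= mxvecK.
congr (vec_mx _ + _); rewrite -mul_vec_lin.
exact: (mulmxA (mxvec W) (lin_mx (mxad X)) (horner_mx (lin_mx (mxad X)) q)).
Qed.

(** The hypothesis on the powers of ad X is linear, so it passes to
    polynomials; the ones of interest have the conjugation as values. *)
Lemma mxad_horner_traceless X U V q :
  (forall j, \tr (U *m iter j (mxad X) V) = 0) ->
  \tr (U *m mxad_poly X q V) = 0.
Proof.
move=> UV.
have iterE j W : iter j (mxad X) (mxad X W) = mxad X (iter j (mxad X) W).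
  by rewrite -iterSr.
elim/poly_ind: q V UV => [|q c IHq] V UV.
  by rewrite /mxad_poly rmorph0 mulmx0 linear0 mulmx0 linear0.
rewrite mxad_polyMXaddC mulmxDr linearD -scalemxAr linearZ /=.
rewrite (UV 0%N) mulr0 addr0 IHq // => j.
by rewrite iterE (UV j.+1).
Qed.

(** Let y be a polynomial in X acting as the conjugate of a on the generalized
    eigenspace of each eigenvalue a.  Then ad y acts as the conjugate of a - b
    on the maps between the eigenspaces of b and a, so it is a polynomial in
    ad X, and
      tr (X y) = sum tr ([U, V] y) = - sum tr (U [y, V]) = 0.
    But tr (X y) is the sum of the squared moduli of the eigenvalues. *)
Lemma trig_commutators_nilpotent (X : 'M[C]_n.+1) (I : finType)
    (U V : I -> 'M[C]_n.+1) :
  is_trig_mx X -> X = \sum_i mxad (U i) (V i) ->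
  (forall i j, \tr (U i *m iter j (mxad X) (V i)) = 0) ->
  X ^+ n.+1 = 0.
Proof.
move=> tX XE UV; pose s := [seq X i i | i : 'I_n.+1].
have sz : size s = n.+1 by rewrite size_image card_ord.
have kill r : (forall a, a \in s -> ('X - a%:P) ^+ n.+1 %| r) -> horner_mx X r = 0.
  move=> sr; apply/eqP; rewrite -dvd_mxminpoly.
  apply: dvdp_trans (mxminpoly_dvd_char _) _.
  rewrite char_poly_trig // -(big_image _ _ _ predT (fun a => 'X - a%:P)) /=.
  by apply: prod_XsubC_dvd => a /sr; rewrite sz.
(* q interpolates the conjugation on eigenvalues, q2 on their differences. *)
have [q qP] := hermite_interpolation s n.+1 Num.conj.
pose c i j := X i i - X j j.
pose s2 := [seq c p.1 p.2 | p : 'I_n.+1 * 'I_n.+1].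
have [q2 q2P] := hermite_interpolation s2 (n.+1 + n.+1) Num.conj.
set y := horner_mx X q.
suff adyE W : mxad y W = mxad_poly X q2 W.
  have trXy : \tr (X *m y) = 0.
    rewrite {1}XE mulmx_suml raddf_sum big1 //= => i _.
    have : \tr (U i *m mxad y (V i)) = 0 by rewrite adyE mxad_horner_traceless.
    rewrite /mxad mulmxBr mulmxBl !raddfB /= => /eqP; rewrite subr_eq0 => /eqP e.
    by rewrite -!mulmxA -e [\tr (V i *m _)]mxtrace_mulC !mulmxA subrr.
  have X0 i : X i i = 0.
    have [ty yE] := trig_horner_mx q tX.
    have [_ XyE] := trig_mxM tX ty.
    have := trXy; rewrite /mxtrace (eq_bigr (fun i => `|X i i| ^+ 2)) => [/eqP|k _].
      rewrite psumr_eq0 => [/allP/(_ i (mem_index_enum _))|k _]; last exact: exprn_ge0.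
      by rewrite /= sqrf_eq0 normr_eq0 => /eqP.
    rewrite XyE yE normCK; congr (_ * _).
    have /dvdp_trans/(_ (qP (X k k) (map_f _ _))) : 'X - (X k k)%:P %| ('X - (X k k)%:P) ^+ n.+1.
      by rewrite exprS dvdp_mulr.
    by move/(_ (mem_enum _ _)); rewrite dvdp_XsubCl /root !hornerE subr_eq0 => /eqP.
  have -> : X ^+ n.+1 = horner_mx X ('X ^+ n.+1) by rewrite rmorphXn /= horner_mx_X.
  apply: kill => a /mapP[i _ ->].
  by rewrite X0 subr0.
(* The e a, evaluated at X, are the projections on generalized eigenspaces. *)
have [e eP] : exists e : C -> {poly C}, forall a b, b \in s ->
    ('X - b%:P) ^+ n.+1 %| e a - ((b == a)%:R)%:P.
  have /choice := fun a => hermite_interpolation s n.+1 (fun b => (b == a)%:R).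
  by case=> e eP; exists e.
pose E a := horner_mx X (e a).
have sumE : \sum_(a <- undup s) E a = 1.
  apply/eqP; rewrite -subr_eq0 -rmorph_sum -(rmorph1 (horner_mx X)) -rmorphB /=.
  apply/eqP/kill => b bs.
  have -> : 1 = \sum_(a <- undup s) ((b == a)%:R)%:P :> {poly C}.
    rewrite (bigD1_seq b) ?undup_uniq ?mem_undup //= eqxx big1 ?addr0 // => a.
    by rewrite eq_sym => /negPf->.
  rewrite -sumrB; elim/big_rec: _ => [|a r _ br]; first exact: dvdp0.
  by rewrite dvdp_add ?eP.
have killE a r : ('X - a%:P) ^+ n.+1 %| r -> horner_mx X r *m E a = 0.
  move=> ar; rewrite -[LHS](rmorphM (horner_mx X)); apply: kill => b sb.
  have [->|ba] := eqVneq b a; first exact: dvdp_mulr.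
  by apply: dvdp_mull; have := eP a b sb; rewrite (negPf ba) subr0.
have comE a r : E a *m horner_mx X r = horner_mx X r *m E a.
  exact: comm_horner_mx2.
have hX a : (X - a%:M) ^+ n.+1 = horner_mx X (('X - a%:P) ^+ n.+1).
  by rewrite rmorphXn (rmorphB (horner_mx X)) /= horner_mx_X horner_mx_C.
have XkillE a : (X - a%:M) ^+ n.+1 *m E a = 0 by rewrite hX killE.
have EkillX a : E a *m (X - a%:M) ^+ n.+1 = 0 by rewrite hX comE killE.
have yE a : a \in s -> y *m E a = a^* *: E a.
  move=> sa; apply/eqP; rewrite -subr_eq0 -mul_scalar_mx -mulmxBl -(horner_mx_C X).
  by rewrite -(rmorphB (horner_mx X)) killE // qP.
have Ey a : a \in s -> E a *m y = a^* *: E a by move=> sa; rewrite comE yE.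
(* On each block E a * W * E b both sides act by the same scalar. *)
have WE : W = \sum_(a <- undup s) \sum_(b <- undup s) E a *m W *m E b.
  transitivity ((\sum_(a <- undup s) E a) *m W *m (\sum_(b <- undup s) E b)).
    by rewrite sumE mul1mx mulmx1.
  rewrite !mulmx_suml; apply: eq_bigr => a _.
  by rewrite mulmx_sumr.
rewrite WE !linear_sum big_seq [RHS]big_seq; apply: eq_bigr => a.
rewrite mem_undup => sa.
rewrite !linear_sum big_seq [RHS]big_seq; apply: eq_bigr => b.
rewrite mem_undup => sb.
rewrite /= (@mxad_poly_generalized_eigen X _ a b n.+1 n.+1 q2 (a - b)^*).
- rewrite /mxad !mulmxA yE // -!mulmxA Ey // -!scalemxAr.
  by rewrite -!scalemxAl -scalerBl rmorphB.
- by rewrite !mulmxA XkillE !mul0mx.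
- by rewrite -!mulmxA EkillX !mulmx0.
- move: sa sb => /mapP[i _ ->] /mapP[j _ ->]; apply: q2P.
  by apply/mapP; exists (i, j); rewrite // mem_enum.
Qed.

(** Schur's triangularization reduces to the previous lemma. *)
Lemma commutators_nilpotent_closed (X : 'M[C]_n.+1) (I : finType)
    (U V : I -> 'M[C]_n.+1) :
  X = \sum_i mxad (U i) (V i) ->
  (forall i j, \tr (U i *m iter j (mxad X) (V i)) = 0) ->
  X ^+ n.+1 = 0.
Proof.
move=> XE UV; have [//|P Pu tX] := @Schur C n.+1 X.
have Punit : P \in unitmx by exact: unitarymx_unit.
pose f A := P *m A *m invmx P.
have fM A B : f (A *m B) = f A *m f B by rewrite /f !mulmxA mulmxKV.
have fB A B : f (A - B) = f A - f B by rewrite /f mulmxBr mulmxBl.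
have fad A B : f (mxad A B) = mxad (f A) (f B) by rewrite /mxad fB !fM.
have fiter j A B : f (iter j (mxad A) B) = iter j (mxad (f A)) (f B).
  by elim: j => //= j <-; rewrite fad.
have ftr A : \tr (f A) = \tr A by rewrite /f mxtrace_mulC mulKmx.
have fX k A : f (A ^+ k) = f A ^+ k.
  elim: k => [|k IHk]; first by rewrite !expr0 /f mulmx1 mulmxV.
  by rewrite !exprS -IHk; apply: fM.
suff: f X ^+ n.+1 = 0.
  rewrite -fX /f => /(congr1 (fun A => invmx P *m A *m P)).
  by rewrite mulmx0 mul0mx -!mulmxA mulKmx // mulVmx // mulmx1.
apply: (@trig_commutators_nilpotent _ I (f \o U) (f \o V)).
- by move: tX; rewrite /similar_to conjumx.
- rewrite {1}XE /f mulmx_sumr mulmx_suml; apply: eq_bigr => i _.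
  exact: fad.
- by move=> i j; rewrite /= -fiter -fM ftr.
Qed.
End TracelessBracket.

Lemma commutators_nilpotent (R : rcfType) n (X : 'M[R]_n.+1) (I : finType)
    (U V : I -> 'M[R]_n.+1) :
  X = \sum_i mxad (U i) (V i) ->
  (forall i j, \tr (U i *m iter j (mxad X) (V i)) = 0) ->
  X ^+ n.+1 = 0.
Proof.
move=> XE UV; pose f := map_mx (real_complex R) : 'M_n.+1 -> 'M_n.+1.
have fad A B : f (mxad A B) = mxad (f A) (f B) by rewrite /f /mxad map_mxB !map_mxM.
have fiter j A B : f (iter j (mxad A) B) = iter j (mxad (f A)) (f B).
  by elim: j => //= j <-; rewrite fad.
suff: f X ^+ n.+1 = 0.
  rewrite -[f X ^+ _](rmorphXn (map_mx (real_complex R))) => /eqP.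
  by rewrite map_mx_eq0 => /eqP.
apply: (@commutators_nilpotent_closed _ _ _ I (f \o U) (f \o V)).
  rewrite {1}XE /f raddf_sum; apply: eq_bigr => i _; exact: fad.
by move=> i j; rewrite /= -fiter /f -map_mxM trace_map_mx UV rmorph0.
Qed.

Lemma mxtrace_nilpotent_closed (C : numClosedFieldType) n (X : 'M[C]_n.+1) k :
  X ^+ k = 0 -> \tr X = 0.
Proof.
move=> Xk0; have [//|P Pu tX] := @Schur C n.+1 X.
have Punit : P \in unitmx by exact: unitarymx_unit.
rewrite /similar_to conjumx // in tX.
have -> : \tr X = \tr (P *m X *m invmx P) by rewrite mxtrace_mulC mulKmx.
have [_ powE] := trig_horner_mx 'X^k tX.
rewrite /mxtrace big1 // => i _; have := powE i.
rewrite horner_mx_uconj // rmorphXn /= horner_mx_X Xk0 mulmx0 mul0mx mxE hornerXn.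
by move/esym/eqP; rewrite expf_eq0 => /andP[_ /eqP].
Qed.

Lemma mxtrace_nilpotent (R : rcfType) n (X : 'M[R]_n.+1) k :
  X ^+ k = 0 -> \tr X = 0.
Proof.
move=> Xk0; have: \tr (map_mx (real_complex R) X) = 0.
  apply: (@mxtrace_nilpotent_closed _ _ _ k).
  by rewrite -[LHS](rmorphXn (map_mx (real_complex R))) Xk0 rmorph0.
by rewrite trace_map_mx => /eqP; rewrite fmorph_eq0 => /eqP.
Qed.

(** * Engel's theorem *)

Lemma span_ind (F : fieldType) (V : vectType F) (K : V -> Prop) (s : seq V) :
  K 0 -> (forall c u v, K u -> K v -> K (c *: u + v)) ->
  (forall u, u \in s -> K u) -> forall v, v \in <<s>>%VS -> K v.
Proof.
move=> K0 KP Ks v /(coord_span (X := in_tuple s)) ->.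
elim/big_rec: _ => // i u _ Ku; apply: KP => //.
by apply: Ks; rewrite mem_nth.
Qed.

Section Engel.
Variables (F : fieldType) (M : vectType F).
Implicit Types (S T x y u : 'End(M)) (U L : {vspace 'End(M)}) (v w : M).

Definition lbr S T : 'End(M) := ((S \o T) - (T \o S))%VF.

Lemma lbrE S T v : lbr S T v = S (T v) - T (S v).
Proof. by rewrite /lbr add_lfunE opp_lfunE !comp_lfunE. Qed.

Lemma lbrC S T : lbr S T = - lbr T S.
Proof. by rewrite /lbr opprB. Qed.

Lemma lbrxx S : lbr S S = 0.
Proof. exact: subrr. Qed.

Lemma lbrP S c x y : lbr S (c *: x + y) = c *: lbr S x + lbr S y.
Proof.
apply/lfunP => w; rewrite lbrE [RHS]add_lfunE scale_lfunE !lbrE !add_lfunE !scale_lfunE linearP.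
by rewrite scalerBr opprD addrACA.
Qed.

(** The ascending series of [U]: vectors killed by all products of [k] elements
    of [U].  It replaces the powers of the associative algebra that [U]
    generates. *)
Fixpoint nilker U k v : Prop :=
  if k is k'.+1 then forall u, u \in U -> nilker U k' (u v) else v = 0.

Lemma nilker0 U k : nilker U k 0.
Proof. by elim: k => //= k IHk u _; rewrite linear0. Qed.

Lemma nilkerP U k c v w : nilker U k v -> nilker U k w -> nilker U k (c *: v + w).
Proof.
elim: k v w => [|k IHk] v w /=; first by move=> -> ->; rewrite scaler0 addr0.
by move=> Uv Uw u uU; rewrite linearP; apply: IHk; [apply: Uv|apply: Uw].
Qed.

Lemma nilkerD U k v w : nilker U k v -> nilker U k w -> nilker U k (v + w).
Proof. by move=> Uv Uw; rewrite -[v]scale1r; apply: nilkerP. Qed.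

Lemma nilkerZ U k c v : nilker U k v -> nilker U k (c *: v).
Proof. by move=> Uv; rewrite -[_ *: v]addr0; apply: nilkerP => //; apply: nilker0. Qed.

Lemma nilkerB U k v w : nilker U k v -> nilker U k w -> nilker U k (v - w).
Proof. by move=> Uv Uw; rewrite addrC -scaleN1r; apply: nilkerP. Qed.

Lemma nilkerS U k v : nilker U k v -> nilker U k.+1 v.
Proof.
elim: k v => [|k IHk] v /= Uv u uU; first by rewrite Uv linear0.
exact/IHk/Uv.
Qed.

Lemma nilker_leq U k l v : (k <= l)%N -> nilker U k v -> nilker U l v.
Proof. by move=> /subnK<-; elim: (l - k)%N => //= m IHm /IHm/nilkerS. Qed.

Lemma nilker_pred U k u v : u \in U -> nilker U k v -> nilker U k.-1 (u v).
Proof. by case: k => [|k] uU Uv /=; [rewrite Uv linear0|apply: Uv]. Qed.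

(** The operators that lower the series of [U] by at least j - N steps form a
    decreasing filtration, which starts with all operators and ends with 0,
    and each commutation with an element of [U] goes down one step.  Hence a
    repeated commutator of an element of L outside U with elements of U must
    eventually enter U; the last one outside U normalizes U. *)
Lemma normalizer_step L U N : (U <= L)%VS -> ~~ (L <= U)%VS ->
  (forall x y, x \in L -> y \in L -> lbr x y \in L) ->
  (forall v, nilker U N v) ->
  exists2 y, y \in L /\ y \notin U & forall u, u \in U -> lbr u y \in U.
Proof.
move=> UL /subvPn[y0 y0L y0U] Lalg UN; apply: contrapT => noy.
have step y : y \in L -> y \notin U ->
    exists2 u, u \in U & lbr u y \in L /\ lbr u y \notin U.
  move=> yL yU; apply: contrapT => nou; apply: noy; exists y => // u uU.
  apply/negPn/negP => uyU; apply: nou; exists u => //; split=> //.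
  by apply: Lalg => //; apply: (subvP UL).
(* The index is shifted by N so that Fil 0 contains every operator. *)
pose Fil j x := forall i v, nilker U i v -> nilker U (i + N - j) (x v).
have chain j : exists y, [/\ y \in L, y \notin U & Fil j y].
  elim: j => [|j [y [yL yU yj]]].
    exists y0; split=> // i v _; apply: nilker_leq (UN _); lia.
  have [u uU [uyL uyU]] := step y yL yU; exists (lbr u y); split=> // i v iv.
  rewrite lbrE; apply: nilkerB.
    have -> : (i + N - j.+1 = (i + N - j).-1)%N by lia.
    by apply: nilker_pred => //; apply: yj.
  case: i iv => [|i] iv; first by rewrite iv !linear0; apply: nilker0.
  have -> : (i.+1 + N - j.+1 = i + N - j)%N by lia.
  exact/yj/iv.
have [y [_ /negP yU yN]] := chain (N + N)%N; apply: yU.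
suff -> : y = 0 by rewrite mem0v.
by apply/lfunP => v; rewrite zero_lfunE; have := yN _ _ (UN v); rewrite subnn.
Qed.

(** As [y] normalizes [U], it preserves the series of [U], and [r] steps along
    the powers of [y] go down one step of that series. *)
Lemma nilker_adjoin U y r k v : (forall u, u \in U -> lbr u y \in U) ->
  (forall v, iter r y v = 0) ->
  nilker U k v -> nilker (U + <[y]>)%VS (k * r) v.
Proof.
move=> Uy yr; elim: k v => [//|k IHk] v Uv.
have stab l w : nilker U l w -> nilker U l (y w).
  elim: l w => [|l IHl] w /=; first by move->; rewrite linear0.
  move=> Uw u uU; rewrite -[u (y w)](subrK (y (u w))) -lbrE.
  by apply: nilkerD; [apply/Uw/Uy|apply/IHl/Uw].
suff claim i : (i <= r)%N -> nilker (U + <[y]>)%VS (k * r + (r - i)) (iter i y v).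
  by have := claim 0%N isT; rewrite subn0 mulSn addnC.
move=> /subKn <-; elim: (r - i)%N (leq_subr i r) => [|j IHj] jr.
  by rewrite subn0 yr; apply: nilker0.
have -> : (k * r + (r - (r - j.+1)) = (k * r + j).+1)%N by lia.
have ijE : iter (r - j) y v = y (iter (r - j.+1) y v).
  by rewrite -iterS; congr iter; lia.
have := IHj (ltnW jr); rewrite ijE (_ : r - (r - j) = j)%N; last by lia.
move=> yj /= _ /memv_addP[u uU [_ /vlineP[c ->] ->]].
rewrite add_lfunE scale_lfunE; apply: nilkerD; last exact: nilkerZ.
apply: (@nilker_leq _ (k * r)); first by rewrite leq_addr.
apply: IHk; suff zk : nilker U k.+1 (iter (r - j.+1) y v) by exact: zk.
by elim: (r - _)%N => [|m]; [exact: Uv|exact: (stab k.+1)].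
Qed.

(** Jacobson's proof: a subalgebra that acts nilpotently as a whole and is not
    yet all of [L] can be enlarged by one of its normalizing elements. *)
Theorem engel L : (forall x y, x \in L -> y \in L -> lbr x y \in L) ->
  (forall x, x \in L -> exists r, forall v, iter r x v = 0) ->
  exists N, forall v, nilker L N v.
Proof.
move=> Lalg Lnil.
suff claim d U N : (\dim L - \dim U <= d)%N -> (U <= L)%VS ->
    (forall x y, x \in U -> y \in U -> lbr x y \in U) ->
    (forall v, nilker U N v) -> exists N, forall v, nilker L N v.
  apply: (claim (\dim L) 0%VS 1%N); rewrite ?sub0v ?leq_subr //.
    move=> x y; rewrite !memv0 => /eqP-> _; apply/eqP/lfunP => v.
    by rewrite lbrE !zero_lfunE linear0 subrr.
  by move=> v u /=; rewrite memv0 => /eqP->; rewrite zero_lfunE.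
elim: d U N => [|d IHd] U N dU UL Ualg UN.
  exists N; suff -> : L = U by [].
  by apply/eqP; rewrite eq_sym eqEdim UL; move: dU; rewrite leqn0 subn_eq0.
have [LU|LU] := boolP (L <= U)%VS.
  by exists N; suff -> : L = U by []; apply/eqP; rewrite eqEsubv LU.
have [y [yL yU] Uy] := normalizer_step UL LU Lalg UN.
have [r yr] := Lnil y yL.
apply: (IHd (U + <[y]>)%VS (N * r)%N).
- have : (\dim U < \dim (U + <[y]>))%N.
    rewrite ltn_neqAle dimvS ?addvSl // andbT; apply: contra yU => /eqP dE.
    have /eqP -> : (U == U + <[y]>)%VS by rewrite eqEdim addvSl dE leqnn.
    by rewrite (subvP (addvSr _ _)) // memv_line.
  by move: dU; lia.
- by rewrite subv_add UL -memvE.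
- move=> _ _ /memv_addP[u uU [_ /vlineP[c ->] ->]] /memv_addP[w wU [_ /vlineP[e ->] ->]].
  apply: (subvP (addvSl _ _)).
  have yU' z : z \in U -> lbr y z \in U by move=> zU; rewrite lbrC rpredN Uy.
  rewrite [u + _]addrC [w + _]addrC lbrP ![lbr (_ + u) _]lbrC !lbrP lbrxx.
  rewrite scaler0 add0r; apply: rpredB; first by rewrite memvZ // memvN yU'.
  by rewrite memvD ?memvZ // ?Uy ?Ualg.
- by move=> v; apply: nilker_adjoin.
Qed.

(** If every element goes down j steps of the series, commutators go down 2j
    steps; when commutators span [L] this forces arbitrarily many steps.
    Perfectness is stated as an induction principle. *)
Lemma perfect_nilpotent_trivial L :
  (forall K : 'End(M) -> Prop, K 0 -> (forall c x y, K x -> K y -> K (c *: x + y)) ->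
     (forall x y, x \in L -> y \in L -> K (lbr x y)) -> forall x, x \in L -> K x) ->
  (forall x y, x \in L -> y \in L -> lbr x y \in L) ->
  (forall x, x \in L -> exists r, forall v, iter r x v = 0) ->
  forall x, x \in L -> x = 0.
Proof.
move=> Lperf Lalg Lnil; have [N LN] := engel Lalg Lnil.
suff lower j x : x \in L -> forall i v, nilker L i v -> nilker L (i - j.+1) (x v).
  move=> x xL; apply/lfunP => v; rewrite zero_lfunE.
  by have := lower N x xL N v (LN v); rewrite (_ : N - N.+1 = 0)%N //; lia.
elim: j x => [|j IHj] x xL; first by move=> i v iv; rewrite subn1; apply: nilker_pred.
move: x xL; apply: Lperf => [i v _|c x y Kx Ky i v iv|x y xL yL i v iv].
- by rewrite zero_lfunE; apply: nilker0.
- by rewrite add_lfunE scale_lfunE; apply: nilkerP; [apply: Kx|apply: Ky].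
- rewrite lbrE; apply: nilkerB.
    by apply: nilker_leq (IHj x xL _ _ (IHj y yL _ _ iv)); lia.
  by apply: nilker_leq (IHj y yL _ _ (IHj x xL _ _ iv)); lia.
Qed.

End Engel.

(** * Traces of endomorphisms and Cartan's criterion *)

Section LinearTools.
Variable F : fieldType.
Implicit Types U V W : vectType F.

Lemma linfunE U V (f : U -> V) : linear f -> linfun f =1 f.
Proof.
move=> fl; pose fL := GRing.isLinear.Build F _ _ _ f fl.
by pose f' : {linear _ -> _} := HB.pack f fL; apply: (lfunE f').
Qed.

Lemma linear_fun0 U V (f : U -> V) : linear f -> f 0 = 0.
Proof. by move=> fl; have := fl (-1) 0 0; rewrite scaler0 addr0 scaleN1r addNr. Qed.

Lemma linear_funB U V (f : U -> V) : linear f -> forall x y, f (x - y) = f x - f y.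
Proof. by move=> fl x y; rewrite -scaleN1r addrC fl scaleN1r addrC. Qed.

Lemma linear_fun_sum U V (f : U -> V) I (r : seq I) (c : I -> F) (u : I -> U) :
  linear f -> f (\sum_(i <- r) c i *: u i) = \sum_(i <- r) c i *: f (u i).
Proof.
move=> fl; elim: r => [|i r IHr]; last by rewrite !big_cons fl IHr.
by rewrite !big_nil linear_fun0.
Qed.

(** The curried linear map with the given values, meaningful when [f] is
    bilinear. *)
Definition bil U V W (f : U -> V -> W) : 'Hom(U, 'Hom(V, W)) :=
  linfun (fun x => linfun (f x)).

Lemma bilE U V W (f : U -> V -> W) : (forall x, linear (f x)) ->
  (forall y, linear (f^~ y)) -> forall x y, bil f x y = f x y.
Proof.
move=> fr fl x y; rewrite linfunE ?linfunE // => c u v; apply/lfunP => w.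
by rewrite add_lfunE scale_lfunE !linfunE // fl.
Qed.

Section CurriedBilinear.
Variables (U V W : vectType F) (b : 'Hom(U, 'Hom(V, W))).

Lemma bilDl x y z : b (x + y) z = b x z + b y z.
Proof. by rewrite linearD add_lfunE. Qed.
Lemma bilDr x y z : b x (y + z) = b x y + b x z. Proof. exact: linearD. Qed.
Lemma bilZl c x z : b (c *: x) z = c *: b x z.
Proof. by rewrite linearZ scale_lfunE. Qed.
Lemma bilZr c x z : b x (c *: z) = c *: b x z. Proof. exact: linearZ. Qed.
Lemma bilNl x z : b (- x) z = - b x z.
Proof. by rewrite linearN opp_lfunE. Qed.
Lemma bilNr x z : b x (- z) = - b x z. Proof. exact: linearN. Qed.
Lemma bilBr x y z : b x (y - z) = b x y - b x z. Proof. exact: linearB. Qed.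
Lemma bil_suml I (r : seq I) (u : I -> U) z :
  b (\sum_(i <- r) u i) z = \sum_(i <- r) b (u i) z.
Proof. by rewrite linear_sum sum_lfunE. Qed.
Lemma bil_sumr I (r : seq I) x (u : I -> V) :
  b x (\sum_(i <- r) u i) = \sum_(i <- r) b x (u i).
Proof. exact: linear_sum. Qed.

End CurriedBilinear.

Lemma v2r_lfun U V (f : 'Hom(U, V)) x : v2r (f x) = v2r x *m f2mx f.
Proof. by rewrite unlock /= r2vK. Qed.

Lemma f2mx_comp U V W (f : 'Hom(V, W)) (g : 'Hom(U, V)) :
  f2mx (f \o g)%VF = f2mx g *m f2mx f.
Proof.
apply/row_matrixP => i; rewrite !rowE mulmxA.
by rewrite -[delta_mx 0 i]r2vK -!v2r_lfun comp_lfunE.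
Qed.

Lemma f2mxP U V c (f g : 'Hom(U, V)) : f2mx (c *: f + g) = c *: f2mx f + f2mx g.
Proof.
apply/row_matrixP => i; rewrite !rowE mulmxDr -scalemxAr.
rewrite -[delta_mx 0 i]r2vK -!v2r_lfun add_lfunE scale_lfunE.
by rewrite linearP.
Qed.

Definition ltrace V (T : 'End(V)) : F := \tr (f2mx T).

Lemma ltraceP V c (S T : 'End(V)) : ltrace (c *: S + T) = c * ltrace S + ltrace T.
Proof. by rewrite /ltrace f2mxP linearP. Qed.

Lemma ltrace0 V : ltrace (0 : 'End(V)) = 0.
Proof.
by have := ltraceP 1 (0 : 'End(V)) 0; rewrite scaler0 addr0 mul1r -[LHS]addr0 => /addrI.
Qed.

Lemma ltraceC V (S T : 'End(V)) : ltrace (S \o T)%VF = ltrace (T \o S)%VF.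
Proof. by rewrite /ltrace !f2mx_comp mxtrace_mulC. Qed.

Lemma ltraceE V (T : 'End(V)) :
  ltrace T = \sum_i v2r (T (r2v (delta_mx 0 i))) 0 i.
Proof. by apply: eq_bigr => i _; rewrite v2r_lfun r2vK -rowE mxE. Qed.

Lemma vect_sum V (v : V) : v = \sum_i v2r v 0 i *: r2v (delta_mx 0 i).
Proof.
apply: v2r_inj; rewrite linear_sum /= {1}[v2r v]row_sum_delta.
by apply: eq_bigr => i _; rewrite linearZ /= r2vK.
Qed.

End LinearTools.

Section Derived.
Variables (R : realType) (V : vectType R) (b : 'Hom(V, 'Hom(V, V))).
Implicit Types (U P I : {vspace V}).

Lemma derived_ind U (K : V -> Prop) : K 0 ->
  (forall c u v, K u -> K v -> K (c *: u + v)) ->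
  (forall u v, u \in U -> v \in U -> K (b u v)) ->
  forall x, x \in derived b U -> K x.
Proof.
move=> K0 KP Kb; apply: span_ind => // _ /allpairsP[[u v] /= [uU vU ->]].
by apply: Kb; apply: vbasis_mem.
Qed.

Lemma mem_derived U u v : u \in U -> v \in U -> b u v \in derived b U.
Proof.
move=> uU vU; rewrite (coord_vbasis uU) linear_sum sum_lfunE.
apply: memv_suml => i _; rewrite linearZ scale_lfunE; apply: memvZ.
rewrite (coord_vbasis vU) linear_sum; apply: memv_suml => j _.
rewrite linearZ; apply/memvZ/memv_span/allpairsP.
by exists ((vbasis U)`_i, (vbasis U)`_j); rewrite !mem_nth ?size_tuple.
Qed.

Lemma derived_subset U I : (forall u v, u \in U -> v \in U -> b u v \in I) ->
  (derived b U <= I)%VS.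
Proof.
move=> UI; apply/subvP => x; apply: (derived_ind (K := fun x => x \in I)) => //
  [|c u v uI vI].
  exact: mem0v.
by rewrite memvD ?memvZ.
Qed.

Lemma derived_sum U x : x \in derived b U ->
  exists2 s : seq (V * V), (forall p, p \in s -> p.1 \in U /\ p.2 \in U) &
    x = \sum_(p <- s) b p.1 p.2.
Proof.
move: x; apply: derived_ind => [|c _ _ [s sU ->] [t tU ->]|u v uU vU].
- by exists [::]; rewrite ?big_nil.
- exists ([seq (c *: p.1, p.2) | p <- s] ++ t) => [p|].
    rewrite mem_cat => /orP[/mapP[q /sU[q1 q2] ->]|/tU //].
    by split; rewrite ?memvZ.
  rewrite big_cat big_map scaler_sumr; congr (_ + _); apply: eq_bigr => p _.
  by rewrite linearZ scale_lfunE.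
- by exists [:: (u, v)]; rewrite ?big_seq1 // => p; rewrite inE => /eqP->.
Qed.

(** The dimension drops at each strict inclusion, so the derived series stops
    at a perfect subalgebra. *)
Lemma derived_series_stable U : (forall u v, u \in U -> v \in U -> b u v \in U) ->
  exists k, derived b (iter k (derived b) U) = iter k (derived b) U /\
            (iter k (derived b) U <= U)%VS.
Proof.
have [d] := ubnP (\dim U); elim: d U => // d IHd U /ltnSE dU Ualg.
have DU := derived_subset Ualg.
have [DE|DN] := eqVneq (derived b U) U; first by exists 0%N.
have dD : (\dim (derived b U) < d)%N.
  apply: leq_trans dU; rewrite ltn_neqAle dimvS // andbT; apply: contra DN.
  by move=> /eqP dE; rewrite eqEdim DU dE leqnn.
have [||k [kD kU]] := IHd (derived b U).
- exact: dD.
- by move=> u v uD vD; apply: mem_derived; apply: (subvP DU).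
- by exists k.+1; rewrite iterSr; split=> //; apply: subv_trans DU.
Qed.

End Derived.

Lemma commutators_nilpotent_mx (R : rcfType) n (X : 'M[R]_n)
    (s : seq ('M[R]_n * 'M[R]_n)) :
  X = \sum_(p <- s) (p.1 *m p.2 - p.2 *m p.1) ->
  (forall p j, p \in s ->
     \tr (p.1 *m iter j (fun W => X *m W - W *m X) p.2) = 0) ->
  exists k, forall v : 'rV_n, iter k (mulmxr X) v = 0.
Proof.
case: n X s => [|n] X s XE sX; first by exists 0%N => v; rewrite thinmx0.
have X0 : X ^+ n.+1 = 0.
  apply: (@commutators_nilpotent _ _ X _ (fun i => (tnth (in_tuple s) i).1)
            (fun i => (tnth (in_tuple s) i).2)).
    by rewrite {1}XE big_tnth.
  by move=> i j; apply: sX; apply: mem_tnth.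
have powE k (v : 'rV_n.+1) : iter k (mulmxr X) v = v *m X ^+ k.
  elim: k => [|k IHk]; first by rewrite expr0 mulmx1.
  by rewrite iterS IHk exprSr [RHS]mulmxA.
by exists n.+1 => v; rewrite powE X0 mulmx0.
Qed.

Section TraceForm.
Variables (R : realType) (V M : vectType R) (b : 'Hom(V, 'Hom(V, V))).
Variable rho : 'Hom(V, 'End(M)).
Implicit Types (U P I : {vspace V}) (x y z : V).

(** The matrix of a composite is the product in the reverse order, which is why
    the two components of each pair are exchanged. *)
Lemma commutators_nilpotent_lfun (X : 'End(M)) (s : seq ('End(M) * 'End(M))) :
  X = \sum_(p <- s) lbr p.1 p.2 ->
  (forall p j, p \in s -> ltrace (p.2 \o iter j (lbr X) p.1)%VF = 0) ->
  exists k, forall v, iter k X v = 0.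
Proof.
move=> XE sX.
have fbr (S T : 'End(M)) : f2mx (lbr S T) = f2mx T *m f2mx S - f2mx S *m f2mx T.
  by rewrite /lbr -!f2mx_comp addrC -scaleN1r f2mxP scaleN1r addrC.
have [||k kX] := @commutators_nilpotent_mx R _ (f2mx X)
    [seq (f2mx p.2, f2mx p.1) | p <- s].
- rewrite big_map {1}XE; elim: s {XE sX} => [|p s IHs]; last first.
    by rewrite !big_cons -IHs -[lbr _ _ + _]addr0 -[lbr p.1 p.2]scale1r addr0 f2mxP scale1r fbr.
  rewrite !big_nil; apply/row_matrixP => i; rewrite !rowE.
  by rewrite -[delta_mx 0 i]r2vK -!v2r_lfun zero_lfunE linear0 mulmx0.
- move=> _ j /mapP[p /(sX p j) + ->] /=; rewrite /ltrace f2mx_comp.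
  suff -> : iter j (fun W => f2mx X *m W - W *m f2mx X) (f2mx p.1)
    = (-1) ^+ j *: f2mx (iter j (lbr X) p.1).
    by rewrite -scalemxAr linearZ /= mxtrace_mulC => ->; rewrite mulr0.
  elim: j => [|j IHj]; first by rewrite expr0 scale1r.
  rewrite !iterS IHj fbr exprS -scalemxAl -scalemxAr -scalerBr.
  by rewrite mulN1r scaleNr -scalerN opprB.
exists k => v; apply: v2r_inj; rewrite linear0 -[RHS](kX (v2r v)).
by elim: k {kX} => // k; rewrite !iterS v2r_lfun => ->.
Qed.

Definition is_rep := forall x y, rho (b x y) = lbr (rho x) (rho y).

Definition tform x y : R := ltrace (rho x \o rho y)%VF.

Hypothesis rhoP : is_rep.

(** Each element of P is a sum of brackets of elements u, v of P, and the traces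
    of rho(u) against iterated brackets of v vanish because these brackets
    stay in P.  So all rho(x) are nilpotent, and a perfect algebra of nilpotent
    operators is zero. *)
Lemma perfect_traceless_trivial P : derived b P = P ->
  (forall x y, x \in P -> y \in P -> tform x y = 0) ->
  forall x, x \in P -> rho x = 0.
Proof.
move=> PP Ptr x xP.
have Pb u v : u \in P -> v \in P -> b u v \in P.
  by move=> uP vP; rewrite -PP mem_derived.
apply: (@perfect_nilpotent_trivial _ _ (rho @: P)%VS); last exact: memv_img.
- move=> K K0 KP Kb _ /memv_imgP[u uP ->]; move: uP; rewrite -{1}PP; move: u.
  apply: (derived_ind (K := fun u => K (rho u))) => [|c u v Ku Kv|u v uP vP].
  + by rewrite linear0.
  + by rewrite linearP; apply: KP.
  + by rewrite rhoP; apply: Kb; apply: memv_img.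
- move=> _ _ /memv_imgP[u uP ->] /memv_imgP[v vP ->].
  by rewrite -rhoP memv_img ?Pb.
- move=> _ /memv_imgP[u uP ->].
  have [s sP uE] : exists2 s : seq (V * V), (forall p, p \in s -> p.1 \in P /\ p.2 \in P) &
      u = \sum_(p <- s) b p.1 p.2 by apply: derived_sum; rewrite PP.
  apply: (@commutators_nilpotent_lfun _ [seq (rho p.1, rho p.2) | p <- s]).
    by rewrite {1}uE linear_sum big_map; apply: eq_bigr => p _; apply: rhoP.
  move=> _ j /mapP[p /sP[p1 p2] ->] /=.
  suff -> : iter j (lbr (rho u)) (rho p.1) = rho (iter j (b u) p.1).
    by apply: Ptr => //; elim: j => //= j IHj; apply: Pb.
  by elim: j => //= j ->; rewrite rhoP.
Qed.
End TraceForm.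

(** * Invariant forms on semisimple Lie algebras *)

Section SymmetricForms.
Variables (F : fieldType) (V : vectType F) (beta : V -> V -> F).
Hypothesis betaC : forall x y, beta x y = beta y x.
Hypothesis betaP : forall x c u v, beta x (c *: u + v) = c * beta x u + beta x v.
Implicit Types (U : {vspace V}) (x y : V).

Lemma form0r x : beta x 0 = 0.
Proof. by have := betaP x 1 0 0; rewrite scaler0 addr0 mul1r -[LHS]addr0 => /addrI. Qed.

Lemma formNr x y : beta x (- y) = - beta x y.
Proof. by rewrite -[- y]addr0 -scaleN1r betaP form0r addr0 mulN1r. Qed.

Lemma formNl x y : beta (- x) y = - beta x y.
Proof. by rewrite betaC formNr betaC. Qed.

Lemma formBl x y z : beta (x - y) z = beta x z - beta y z.
Proof. by rewrite addrC -scaleN1r betaC betaP !(betaC z) mulN1r addrC. Qed.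

Lemma form_sumr I (r : seq I) x (c : I -> F) (u : I -> V) :
  beta x (\sum_(i <- r) c i *: u i) = \sum_(i <- r) c i * beta x (u i).
Proof.
by elim: r => [|i r IHr]; rewrite ?big_nil ?form0r // !big_cons betaP IHr.
Qed.

Lemma form_suml I (r : seq I) x (c : I -> F) (u : I -> V) :
  beta (\sum_(i <- r) c i *: u i) x = \sum_(i <- r) c i * beta (u i) x.
Proof. by rewrite betaC form_sumr; apply: eq_bigr => i _; rewrite betaC. Qed.

Definition orth U : {vspace V} :=
  lker (bil (fun x y => beta x (projv U y) : F^o)).

Lemma orthP U x : reflect (forall y, y \in U -> beta x y = 0) (x \in orth U).
Proof.
have lr z : linear (fun y => beta z (projv U y) : F^o).
  by move=> c u v; rewrite linearP betaP.
have ll z : linear (fun y => beta y (projv U z) : F^o).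
  by move=> c u v; rewrite betaC betaP ![beta (projv _ _) _]betaC.
rewrite memv_ker; apply: (iffP eqP) => [/lfunP xU y yU|xU].
  by have := xU y; rewrite bilE // projv_id // zero_lfunE.
by apply/lfunP => y; rewrite bilE // zero_lfunE xU ?memv_proj.
Qed.

Definition nondegenerate_on U :=
  forall x, x \in U -> (forall y, y \in U -> beta x y = 0) -> x = 0.

Definition dual_bases U n (e f : 'I_n -> V) :=
  [/\ forall i, e i \in U, forall i, f i \in U,
      forall i j, beta (e i) (f j) = (i == j)%:R,
      forall u, u \in U -> u = \sum_i beta u (f i) *: e i &
      forall u, u \in U -> u = \sum_i beta u (e i) *: f i].

(** The Gram matrix of a basis is invertible; its inverse gives the dual
    basis. *)
Lemma dual_bases_exist U : nondegenerate_on U ->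
  exists e f : 'I_(\dim U) -> V, dual_bases U e f.
Proof.
move=> nondeg; pose X := vbasis U; pose e (i : 'I_(\dim U)) := X`_i.
have eU i : e i \in U by rewrite vbasis_mem ?mem_nth ?size_tuple.
pose G := \matrix_(i, j) beta (e i) (e j).
have Gunit : G \in unitmx.
  rewrite -row_free_unit; apply/inj_row_free => v vG0.
  have v0 : \sum_i v 0 i *: e i = 0.
    apply: nondeg => [|y yU]; first by apply: memv_suml => i _; rewrite memvZ.
    rewrite (coord_vbasis yU) form_sumr big1 // => j _; rewrite form_suml.
    have /rowP/(_ j) := vG0; rewrite !mxE => vGj.
    rewrite (_ : \sum_i _ = 0) ?mulr0 //.
    by rewrite -[RHS]vGj; apply: eq_bigr => i _; rewrite mxE.
  by apply/rowP => i; rewrite mxE; apply: (freeP (basis_free (vbasisP U)) (v 0) v0).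
pose f j := \sum_k invmx G k j *: e k.
have fU j : f j \in U by apply: memv_suml => k _; rewrite memvZ.
have ef i j : beta (e i) (f j) = (i == j)%:R.
  rewrite form_sumr; have /matrixP/(_ i j) := mulmxV Gunit; rewrite !mxE => <-.
  by apply: eq_bigr => k _; rewrite mxE mulrC.
have euE u : u \in U -> u = \sum_i beta u (f i) *: e i.
  move=> uU; rewrite {1}(coord_vbasis uU); apply: eq_bigr => i _; congr (_ *: _).
  rewrite [in RHS](coord_vbasis uU) form_suml (bigD1 i) //= ef eqxx mulr1.
  by rewrite big1 ?addr0 // => j /negPf ji; rewrite ef ji mulr0.
exists e, f; split=> // u uU; apply/eqP; rewrite -subr_eq0; apply/eqP.
apply: nondeg => [|y yU].
  by rewrite memvB // memv_suml // => i _; rewrite memvZ.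
rewrite (euE y yU) form_sumr big1 // => j _.
rewrite [beta _ (e j)]betaC -scaleN1r addrC betaP form_sumr (bigD1 j) //= ef eqxx.
rewrite big1 => [|i /negPf ij].
  by rewrite mulr1 [beta (e j) u]betaC; ring.
by rewrite ef eq_sym ij mulr0.
Qed.

Lemma orth_decomposition U : nondegenerate_on U ->
  forall x, exists2 u, u \in U & x - u \in orth U.
Proof.
move=> /dual_bases_exist[e [f [eU fU ef euE fuE]]] x.
exists (\sum_i beta x (f i) *: e i).
  by apply: memv_suml => i _; rewrite memvZ.
apply/orthP => y yU; rewrite (fuE y yU) form_sumr big1 // => j _.
rewrite [beta _ (f j)]betaC -scaleN1r addrC betaP form_sumr (bigD1 j) //=.
rewrite [beta (f j) (e j)]betaC ef eqxx big1 => [|i /negPf ij].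
  by rewrite mulr1 [beta (f j) x]betaC; ring.
by rewrite [beta (f j) _]betaC ef ij mulr0.
Qed.

Lemma ltrace_dual_bases n (e f : 'I_n -> V) (T : 'End(V)) :
  dual_bases fullv e f -> ltrace T = \sum_i beta (T (f i)) (e i).
Proof.
case=> _ _ _ _ fE; rewrite ltraceE.
under eq_bigr => k _.
  rewrite (fE (r2v (delta_mx 0 k)) (memvf _)) !linear_sum summxE /=.
  over.
rewrite exchange_big; apply: eq_bigr => i _.
rewrite [T (f i)]vect_sum form_suml; apply: eq_bigr => k _.
by rewrite !linearZ mxE mulrC.
Qed.

End SymmetricForms.

Section InvariantForms.
Variables (R : realType) (V M : vectType R) (b : 'Hom(V, 'Hom(V, V))).
Variable rho : 'Hom(V, 'End(M)).
Hypothesis lieb : lie_bracket b.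
Hypothesis rhoP : is_rep b rho.
Implicit Types (U I : {vspace V}) (x y z : V).

Lemma bracketxx x : b x x = 0. Proof. by case: lieb => ->. Qed.

Lemma bracketC x y : b x y = - b y x.
Proof.
apply/eqP; rewrite -addr_eq0; apply/eqP; have := bracketxx (x + y).
by rewrite bilDl !bilDr !bracketxx add0r addr0.
Qed.

Lemma tformC x y : tform rho x y = tform rho y x. Proof. exact: ltraceC. Qed.

Lemma tformP x c u v : tform rho x (c *: u + v) = c * tform rho x u + tform rho x v.
Proof. by rewrite /tform linearP comp_lfunDr -comp_lfunZr ltraceP. Qed.

Lemma tformNl x y : tform rho (- x) y = - tform rho x y.
Proof. exact: (formNl tformC tformP). Qed.

Lemma ltraceB (T S : 'End(M)) : ltrace (T - S) = ltrace T - ltrace S.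
Proof. by rewrite addrC -scaleN1r ltraceP mulN1r addrC. Qed.

Lemma tform_invariant x y z : tform rho (b x y) z = tform rho x (b y z).
Proof.
rewrite /tform !rhoP /lbr; set X := rho x; set Y := rho y; set Z := rho z.
rewrite comp_lfunDl comp_lfunDr comp_lfunNl comp_lfunNr !ltraceB -!comp_lfunA.
by congr (_ - _); rewrite ltraceC -comp_lfunA.
Qed.

Lemma orth_ideal I : lie_ideal b I -> lie_ideal b (orth (tform rho) I).
Proof.
move=> idI x y /(orthP tformC tformP) yI; apply/(orthP tformC tformP) => z zI.
by rewrite bracketC tformNl tform_invariant yI ?oppr0 // idI.
Qed.

Lemma lker_rep_ideal : lie_ideal b (lker rho).
Proof.
move=> x y; rewrite !memv_ker => /eqP ry; rewrite rhoP ry.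
by apply/eqP/lfunP => v; rewrite lbrE !zero_lfunE linear0 subrr.
Qed.

Lemma ideal_cap I J : lie_ideal b I -> lie_ideal b J -> lie_ideal b (I :&: J)%VS.
Proof.
by move=> idI idJ x y /memv_capP[yI yJ]; apply/memv_capP; rewrite idI ?idJ.
Qed.

(** The last term of the derived series of J is perfect, hence acts
    trivially. *)
Lemma traceless_ideal_derived J : lie_ideal b J ->
  (forall x y, x \in J -> y \in J -> tform rho x y = 0) ->
  exists k, let P := iter k (derived b) J in
    [/\ derived b P = P, (P <= J)%VS & (P <= lker rho)%VS].
Proof.
move=> idJ J0; have [u v _ vJ|k [PP PJ]] := @derived_series_stable _ _ b J.
  exact: idJ.
exists k; split=> //; apply/subvP => x xP; rewrite memv_ker; apply/eqP.
apply: (perfect_traceless_trivial rhoP PP) => // y z yP zP.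
by apply: J0; apply: (subvP PJ).
Qed.

(** By invariance, the matrix of ad x in the basis [e] is minus the transpose
    of its matrix in the dual basis [f].  This is why Casimir elements commute
    with the action. *)
Let dual_bases_invariant_bil I n (e f : 'I_n -> V) (W : vectType R)
    (B : 'Hom(V, 'Hom(V, W))) x :
  lie_ideal b I -> dual_bases (tform rho) I e f ->
  \sum_i B (b x (e i)) (f i) = - \sum_i B (e i) (b x (f i)).
Proof.
move=> idI [eI fI ef eE fE]; apply/eqP; rewrite -addr_eq0; apply/eqP.
under eq_bigr => i _ do rewrite {1}(eE (b x (e i)) (idI _ _ (eI i))) bil_suml.
under [X in _ + X]eq_bigr => i _ do
  rewrite {1}(fE (b x (f i)) (idI _ _ (fI i))) bil_sumr.
rewrite [X in _ + X]exchange_big -big_split big1 //= => i _.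
rewrite -big_split big1 //= => j _; rewrite bilZl bilZr -scalerDl.
rewrite (_ : _ + _ = 0) ?scale0r //.
by rewrite bracketC tformNl tform_invariant tformC addNr.
Qed.

Lemma dual_bases_invariant I n (e f : 'I_n -> V) (W : vectType R)
    (B : V -> V -> W) x :
  lie_ideal b I -> dual_bases (tform rho) I e f ->
  (forall u, linear (B u)) -> (forall u, linear (B^~ u)) ->
  \sum_i B (b x (e i)) (f i) = - \sum_i B (e i) (b x (f i)).
Proof.
move=> idI ef Br Bl; under eq_bigr => i _ do rewrite -(bilE Br Bl).
under [X in _ = - X]eq_bigr => i _ do rewrite -(bilE Br Bl).
exact: dual_bases_invariant_bil idI ef.
Qed.

End InvariantForms.

Section Semisimple.
Variables (R : realType) (V : vectType R) (b : 'Hom(V, 'Hom(V, V))).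
Hypotheses (lieb : lie_bracket b) (ssb : semisimple b).
Implicit Types (U I : {vspace V}) (x y z : V).

Lemma ad_is_rep : is_rep b b.
Proof.
move=> x y; apply/lfunP => z; rewrite lbrE; case: (lieb) => _ jac.
have := jac x y z; rewrite [b z (b x y)](bracketC lieb) [b z x](bracketC lieb).
by rewrite bilNr => /subr0_eq.
Qed.

Definition killing := tform b.

(** The radical of the Killing form is an ideal, and the perfect part of its
    derived series is central, so the radical is solvable. *)
Lemma killing_nondegenerate : nondegenerate_on killing fullv.
Proof.
pose J := orth killing fullv.
have idJ : lie_ideal b J by apply: (orth_ideal lieb ad_is_rep) => x y _; apply: memvf.
suff J0 : J = 0%VS.
  move=> x _ xV; apply/eqP; rewrite -memv0 -J0.
  by apply/(orthP (@tformC _ _ _ b) (@tformP _ _ _ b)).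
apply: ssb => //.
have [|k [PP PJ Pker]] := traceless_ideal_derived ad_is_rep idJ.
  move=> x y /(orthP (@tformC _ _ _ b) (@tformP _ _ _ b)) xV _; apply: xV.
  exact: memvf.
exists k; set P := iter _ _ _ in PP PJ Pker *; rewrite -PP.
apply/eqP; rewrite -subv0; apply: derived_subset => u v uP _.
by rewrite memv0; move: (subvP Pker _ uP); rewrite memv_ker => /eqP->; rewrite zero_lfunE.
Qed.

Lemma killing_dual_bases : exists n (e f : 'I_n -> V), dual_bases killing fullv e f.
Proof.
have [e [f ef]] := dual_bases_exist (@tformC _ _ _ b) (@tformP _ _ _ b) killing_nondegenerate.
by exists (\dim {:V}), e, f.
Qed.

(** Pairing with y and using invariance turns the left-hand side into the trace
    of ad y o ad x computed in dual bases, which is the Killing form of x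
    and y. *)
Lemma casimir_adjoint n (e f : 'I_n -> V) x : dual_bases killing fullv e f ->
  \sum_i b (e i) (b (f i) x) = x.
Proof.
move=> ef; apply/eqP; rewrite -subr_eq0; apply/eqP.
apply: killing_nondegenerate => [|y _]; first exact: memvf.
have KC := @tformC _ _ _ b; have KP := @tformP _ _ _ b.
rewrite /killing (formBl KC KP); apply/eqP; rewrite subr_eq0; apply/eqP.
rewrite (eq_bigr (fun i => 1 *: b (e i) (b (f i) x))); last by move=> *; rewrite scale1r.
rewrite (form_suml KC KP) [RHS]KC.
rewrite [RHS](ltrace_dual_bases KC KP _ ef); apply: eq_bigr => i _.
rewrite mul1r (tform_invariant ad_is_rep) KC comp_lfunE; congr (tform b _ _).
by rewrite (bracketC lieb) (bracketC lieb _ x) bilNr opprK.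
Qed.

End Semisimple.

(** * Whitehead's lemmas *)

Section Coordinates.
Variables (F : fieldType) (V : vectType F).
Implicit Types x y : V.

Lemma v2r_eq x y : (forall j, v2r x 0 j = v2r y 0 j) -> x = y.
Proof. by move=> xy; apply/v2r_inj/rowP. Qed.
Lemma v2rDE x y j : v2r (x + y) 0 j = v2r x 0 j + v2r y 0 j.
Proof. by rewrite linearD mxE. Qed.
Lemma v2rNE x j : v2r (- x) 0 j = - v2r x 0 j.
Proof. by rewrite linearN mxE. Qed.
Lemma v2rZE c x j : v2r (c *: x) 0 j = c * v2r x 0 j.
Proof. by rewrite linearZ mxE. Qed.
Lemma v2r0E j : v2r (0 : V) 0 j = 0.
Proof. by rewrite linear0 mxE. Qed.
Definition v2rE := (v2rDE, v2rNE, v2rZE, v2r0E).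
End Coordinates.

(** Identities between linear combinations of vectors, read off on
    coordinates. *)
Ltac vring := apply: v2r_eq => ?; rewrite !v2rE; ring.

Section SecondWhitehead.
Variables (R : realType) (V : vectType R) (b : 'Hom(V, 'Hom(V, V))).
Hypotheses (lieb : lie_bracket b) (ssb : semisimple b).
Variables (n : nat) (e f : 'I_n -> V).
Hypothesis ef : dual_bases (killing b) fullv e f.
Implicit Types (x y z : V) (s : 'Hom(V, 'Hom(V, V))).

(** The derivative of the Jacobi identity at [b] in the direction [s]; for
    alternating [s] it is the Chevalley-Eilenberg differential of the
    2-cochain [s]. *)
Definition jacobi_linearized s x y z : V :=
  b x (s y z) + b y (s z x) + b z (s x y) +
  (s x (b y z) + s y (b z x) + s z (b x y)).

Definition casimir_contraction s : 'End(V) :=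
  linfun (fun y => \sum_i b (e i) (s (f i) y)).

Lemma casimir_contractionE s y :
  casimir_contraction s y = \sum_i b (e i) (s (f i) y).
Proof.
rewrite linfunE // => c u v; rewrite scaler_sumr -big_split.
by apply: eq_bigr => i _; rewrite /= bilDr bilZr bilDr bilZr.
Qed.

(** For the contraction h with the Casimir element, d h + h d is the action of
    the Casimir element, here the identity: moving [x] across the dual bases
    turns d (h s) into a contraction of the terms of the differential of [s],
    all of them but the one that gives back [s]. *)
Lemma second_whitehead_homotopy s x y : (forall u v, s u v = - s v u) ->
  b x (casimir_contraction s y) - b y (casimir_contraction s x)
    - casimir_contraction s (b x y)
  = s x y - \sum_i b (e i) (jacobi_linearized s (f i) x y).
Proof.
move=> sC.
have bad u v w : b (b u v) w = b u (b v w) - b v (b u w).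
  by rewrite (ad_is_rep lieb) lbrE.
have move_x u w : b u (casimir_contraction s w)
    = \sum_i b (e i) (b u (s (f i) w) - s (b u (f i)) w).
  have idf : lie_ideal b fullv by move=> *; apply: memvf.
  have := dual_bases_invariant lieb (ad_is_rep lieb) (B := fun v z => b v (s z w))
    u idf ef.
  move=> /(_ _ _)/= sw; rewrite (eq_bigr _ (fun i _ => bad _ _ _)) sumrB in sw.
  rewrite casimir_contractionE bil_sumr -[LHS](subrK (\sum_i b (e i) (b u (s (f i) w)))) sw.
  - by rewrite addrC -sumrB; apply: eq_bigr => i _; rewrite bilBr.
  - by move=> v c v1 v2; rewrite bilDl bilZl bilDr bilZr.
  - by move=> v c v1 v2; rewrite bilDl bilZl.
rewrite !move_x casimir_contractionE -!sumrB -{1}(casimir_adjoint lieb ssb (s x y) ef).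
rewrite -sumrB; apply: eq_bigr => i _; rewrite -!bilBr; congr (b _ _).
rewrite /jacobi_linearized [s y (f i)]sC [s x (b y _)]sC [s y (b _ x)]sC bilNr.
by rewrite (bracketC lieb (f i) x) bilNl; vring.
Qed.

End SecondWhitehead.

Section NilpotentTrace.
Variables (R : realType) (M : vectType R).
Implicit Types (C : 'End(M)) (v : M).

Lemma ltrace_nilpotent C k : (forall v, iter k C v = 0) -> ltrace C = 0.
Proof.
move=> Ck0; rewrite /ltrace; move: (f2mx C) (v2r_lfun C) => X CX.
have Xk (v : 'rV_(dim M)) : iter k (mulmxr X) v = 0.
  have iterE j u : iter j (mulmxr X) (v2r u) = v2r (iter j C u).
    by elim: j => // j IHj; rewrite !iterS IHj /= -CX.
  by rewrite -[v]r2vK iterE Ck0 linear0.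
case: (dim M) X Xk {CX} => [|m] X Xk; first by rewrite /mxtrace big_ord0.
apply: (@mxtrace_nilpotent _ _ _ k); apply/row_matrixP => i; rewrite !rowE mulmx0.
rewrite -[RHS](Xk (delta_mx 0 i)); elim: (k) (delta_mx 0 i) => [|j IHj] v.
  by rewrite expr0 mulmx1.
by rewrite iterSr exprS [LHS]mulmxA IHj.
Qed.

(** Some power [T] of [C] has a kernel of maximal dimension among all powers;
    then the kernel and the image of [T] are complementary. *)
Lemma fitting C : exists N (T : 'End(M)),
  [/\ forall v, T v = iter N.+1 C v,
      forall v, T (T v) = 0 -> T v = 0 &
      forall v, exists u, T (v - T u) = 0].
Proof.
pose T k : 'End(M) := iter k (comp_lfun C) \1%VF.
have TE k v : T k v = iter k C v.
  by elim: k => [|k IHk]; rewrite ?id_lfunE // /T iterS comp_lfunE IHk.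
pose P d := `[< exists k, \dim (lker (T k)) = d >].
have exP : exists d, P d by exists (\dim (lker (T 0%N))); apply/asboolP; exists 0%N.
have [|_ /asboolP[N <-] maxN] := ex_maxnP (m := \dim {:M}) exP.
  by move=> _ /asboolP[k <-]; apply/dimvS/subvf.
have TT v : T N.+1 (T N.+1 v) = T (N.+1 + N.+1)%N v by rewrite !TE iterD.
have kerS k l : (lker (T k) <= lker (T (l + k)%N))%VS.
  apply/subvP => w; rewrite !memv_ker !TE iterD => /eqP->; apply/eqP.
  by elim: l => // l IHl; rewrite iterS IHl linear0.
have stable v : T N.+1 (T N.+1 v) = 0 -> T N.+1 v = 0.
  rewrite TT => v0; have/eqP kE : lker (T N.+1) == lker (T (N.+1 + N.+1)%N).
    rewrite eqEdim kerS (leq_trans _ (dimvS (kerS N 1%N))) // maxN //.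
    by apply/asboolP; exists (N.+1 + N.+1)%N.
  by apply/eqP; rewrite -memv_ker kE memv_ker v0.
exists N, (T N.+1); split=> // v.
have cap0 : (lker (T N.+1) :&: limg (T N.+1) = 0)%VS.
  apply/eqP; rewrite -subv0; apply/subvP => w /memv_capP[].
  rewrite memv_ker memv0 => /eqP w0 /memv_imgP[u _ wE].
  by rewrite wE stable // -wE.
have full : (lker (T N.+1) + limg (T N.+1))%VS = fullv.
  apply/eqP; rewrite eqEdim subvf /= dimv_disjoint_sum //.
  by rewrite -(limg_ker_dim (T N.+1) fullv) capfv addnC.
have /memv_addP[k kK [_ /memv_imgP[u _ ->] vE]] : v \in (lker (T N.+1) + limg (T N.+1))%VS.
  by rewrite full memvf.
by exists u; rewrite vE addrK; apply/eqP; rewrite -memv_ker.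
Qed.

End NilpotentTrace.

Section FirstWhitehead.
Variables (R : realType) (V : vectType R) (b : 'Hom(V, 'Hom(V, V))).
Hypotheses (lieb : lie_bracket b) (ssb : semisimple b).
Implicit Types (M : vectType R) (x y z : V).

(** The intersection of an ideal and its orthogonal is an abelian ideal, by
    invariance, so it is zero. *)
Lemma killing_orth_complement K : lie_ideal b K ->
  let I := orth (killing b) K in
  [/\ lie_ideal b I, (K :&: I = 0)%VS &
      forall x, exists2 k, k \in K & x - k \in I].
Proof.
have KC := @tformC _ _ _ b; have KP := @tformP _ _ _ b.
move=> idK I; have idI : lie_ideal b I by apply: (orth_ideal lieb (ad_is_rep lieb)).
have KI : (K :&: I = 0)%VS.
  apply: ssb; first exact: ideal_cap.
  exists 1%N; apply/eqP; rewrite -subv0; apply: derived_subset => u v.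
  move=> /memv_capP[_ /(orthP KC KP) uK] /memv_capP[vK _]; rewrite memv0; apply/eqP.
  apply: (killing_nondegenerate lieb ssb) => [|z _]; first exact: memvf.
  rewrite /killing (tform_invariant (ad_is_rep lieb)) uK //.
  by rewrite (bracketC lieb) memvN idK.
split=> //; apply: (orth_decomposition KC KP) => x xK xK0.
by apply/eqP; rewrite -memv0 -KI; apply/memv_capP; split=> //; apply/(orthP KC KP).
Qed.

(** The radical of the trace form inside the complement of the kernel of [rho]
    is an ideal; the perfect part of its derived series acts trivially, so it
    lies in the kernel and vanishes. *)
Lemma tform_nondegenerate M (rho : 'Hom(V, 'End(M))) : is_rep b rho ->
  nondegenerate_on (tform rho) (orth (killing b) (lker rho)).
Proof.
move=> rhoP; set I := orth _ _.
have BC := @tformC _ _ _ rho; have BP := @tformP _ _ _ rho.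
have [idI KI VKI] := killing_orth_complement (lker_rep_ideal rhoP).
pose J := (I :&: orth (tform rho) fullv)%VS.
suff J0 : J = 0%VS.
  move=> x xI x0; apply/eqP; rewrite -memv0 -J0; apply/memv_capP; split=> //.
  apply/(orthP BC BP) => y _; have [k + ykI] := VKI y.
  rewrite memv_ker => /eqP k0; have -> : y = 1 *: k + (y - k).
    by rewrite scale1r addrC subrK.
  by rewrite BP [tform rho x (y - k)]x0 // /tform k0 comp_lfun0r ltrace0 mulr0 addr0.
have idJ : lie_ideal b J.
  apply: ideal_cap => //; apply: (orth_ideal lieb rhoP) => x y _; apply: memvf.
apply: ssb => //.
have [|k [PP PJ Pker]] := traceless_ideal_derived rhoP idJ.
  by move=> x y /memv_capP[_ /(orthP BC BP) xV] _; apply/xV/memvf.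
exists k; apply/eqP; rewrite -subv0 -KI subv_cap Pker.
by apply: subv_trans PJ _; apply: capvSl.
Qed.

Definition cocycle M (rho : 'Hom(V, 'End(M))) (d : 'Hom(V, M)) :=
  forall x y, d (b x y) = rho x (d y) - rho y (d x).

(** C is the Casimir element of the trace form restricted to the orthogonal of
    the kernel: its trace is the dimension of that ideal, and the primitive of
    C o d is the contraction of d with the dual bases. *)
Lemma first_whitehead_casimir M (rho : 'Hom(V, 'End(M))) : is_rep b rho ->
  rho <> 0 -> exists C : 'End(M),
    [/\ ltrace C != 0, forall x v, rho x (C v) = C (rho x v) &
     forall d, cocycle rho d -> exists w, forall x, rho x w = C (d x)].
Proof.
move=> rhoP rho0; set I := orth (killing b) (lker rho).
have BC := @tformC _ _ _ rho; have BP := @tformP _ _ _ rho.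
have [idI KI VKI] := killing_orth_complement (lker_rep_ideal rhoP).
have [e [f ef]] := dual_bases_exist BC BP (tform_nondegenerate rhoP).
have rbr x y v : rho (b x y) v = rho x (rho y v) - rho y (rho x v).
  by rewrite rhoP lbrE.
exists (\sum_i (rho (e i) \o rho (f i))%VF); split.
- have trsum (s : seq 'I_(\dim I)) :
      ltrace (\sum_(i <- s) (rho (e i) \o rho (f i))%VF) = (size s)%:R.
    elim: s => [|i s IHs]; first by rewrite big_nil ltrace0.
    rewrite big_cons -[X in ltrace (X + _)]scale1r ltraceP IHs mul1r.
    by case: ef => _ _ /(_ i i); rewrite eqxx /tform => -> _ _; rewrite -natrD.
  rewrite trsum pnatr_eq0 -[index_enum _]enumT size_enum_ord dimv_eq0.
  apply/eqP => I0; apply: rho0; apply/lfunP => x; rewrite zero_lfunE.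
  have [k kK] := VKI x; rewrite -/I I0 memv0 subr_eq0 => /eqP->.
  by apply/eqP; rewrite -memv_ker.
- move=> x v; rewrite !sum_lfunE linear_sum.
  under eq_bigr => i _ do rewrite comp_lfunE.
  under [RHS]eq_bigr => i _ do rewrite comp_lfunE.
  have := dual_bases_invariant lieb rhoP (B := fun y z => rho y (rho z v)) x idI ef.
  move=> /(_ _ _)/= sw; rewrite (eq_bigr _ (fun i _ => rbr x (e i) _)) sumrB in sw.
  rewrite -[LHS](subrK (\sum_i rho (e i) (rho x (rho (f i) v)))) sw.
  + rewrite addrC -sumrB; apply: eq_bigr => i _.
    by rewrite -linearB rbr opprB addrC subrK.
  + by move=> u c v1 v2; rewrite bilDl bilZl linearP.
  + by move=> u c v1 v2; rewrite bilDl bilZl.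
- move=> d dP; exists (\sum_i rho (e i) (d (f i))) => x.
  rewrite sum_lfunE linear_sum.
  under [RHS]eq_bigr => i _ do rewrite comp_lfunE.
  have := dual_bases_invariant lieb rhoP (B := fun y z => rho y (d z)) x idI ef.
  move=> /(_ _ _)/= sw; rewrite (eq_bigr _ (fun i _ => rbr x (e i) _)) sumrB in sw.
  rewrite -[LHS](subrK (\sum_i rho (e i) (rho x (d (f i))))) sw.
  + rewrite addrC -sumrB; apply: eq_bigr => i _.
    by rewrite -linearB dP opprB addrC subrK.
  + by move=> u c v1 v2; rewrite !linearP.
  + by move=> u c v1 v2; rewrite bilDl bilZl.
Qed.

(** Induction on the dimension of M.  With T a power of C as in [fitting],
    T o d is a coboundary, and subtracting a coboundary from d makes it take
    its values in the kernel of T, a proper submodule because C is not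
    nilpotent. *)
Theorem first_whitehead M (rho : 'Hom(V, 'End(M))) (d : 'Hom(V, M)) :
  is_rep b rho -> cocycle rho d -> exists m, forall x, d x = rho x m.
Proof.
have [N] := ubnP (\dim {:M}); elim: N M rho d => // N IHN M rho d /ltnSE dN rhoP dP.
have [rho0|/eqP/(first_whitehead_casimir rhoP)[C [trC Crho Cd]]] := eqVneq rho 0.
  have db x y : d (b x y) = 0.
    by rewrite dP rho0 !zero_lfunE subrr.
  have [n [e [f ef]]] := killing_dual_bases lieb ssb.
  by exists 0 => x; rewrite linear0 -(casimir_adjoint lieb ssb x ef) linear_sum big1 // => i _; apply: db.
(* C o d is the coboundary of w, so T o d is that of C^k w. *)
have [w wE] := Cd d dP.
have [k [T [TE Tstable Tfull]]] := fitting C.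
have Trho x v : rho x (T v) = T (rho x v).
  rewrite !TE; elim: k.+1 => // j IHj; by rewrite !iterS Crho IHj.
have Td x : T (d x) = rho x (iter k C w).
  rewrite TE iterSr -wE; elim: (k) => // j IHj; by rewrite !iterS IHj Crho.
have [u Tu] := Tfull (iter k C w).
have Tdu x : T (d x - rho x u) = 0.
  apply: Tstable; rewrite [T (d x - _)]linearB /= -Trho Td -linearB -Trho Tu.
  exact: linear0.
pose M0 := lker T; pose M' := subvs_of M0.
have stab x v : v \in M0 -> rho x v \in M0.
  by rewrite !memv_ker -Trho => /eqP->; rewrite linear0.
pose rho' := bil (fun x (v : M') => vsproj M0 (rho x (vsval v))).
have rho'E x v : vsval (rho' x v) = rho x (vsval v).
  rewrite bilE ?vsprojK // ?stab ?subvsP // => [y|y] c v1 v2.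
    by rewrite !linearP.
  by rewrite linearP add_lfunE scale_lfunE linearP.
pose d' : 'Hom(V, M') := linfun (fun x => vsproj M0 (d x - rho x u)).
have d'E x : vsval (d' x) = d x - rho x u.
  rewrite linfunE ?vsprojK // ?memv_ker ?Tdu // => c x1 x2.
  by rewrite !linearP add_lfunE scale_lfunE opprD addrACA -scalerBr linearP.
have [|||m mE] := IHN M' rho' d'.
- apply: leq_trans dN; rewrite dimvf -[dim M']/(\dim M0) ltn_neqAle dimvS ?subvf // andbT.
  apply: contra trC => /eqP dimM0; apply/eqP/(@ltrace_nilpotent _ _ _ k.+1) => v.
  have /eqP M0E : M0 == fullv by rewrite eqEdim subvf dimM0 leqnn.
  by rewrite -TE; apply/eqP; rewrite -memv_ker -/M0 M0E memvf.
- by move=> x y; apply/lfunP => v; apply/subvs_inj; rewrite lbrE linearB /= !rho'E rhoP lbrE.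
- move=> x y; apply/subvs_inj; rewrite linearB /= !rho'E !d'E dP rhoP lbrE !linearB /=.
  by vring.
exists (u + vsval m) => x.
by rewrite linearD /= -rho'E -mE d'E addrC subrK.
Qed.

End FirstWhitehead.

(** * Norms and convergence in finite dimension *)

HB.instance Definition _ (R : realType) m n := Complete.on 'M[R]_(m, n).

Section Norm.
Variable R : realType.
Implicit Types U V W : vectType R.

Definition vnorm V (v : V) : R := `|v2r v|.

Lemma vnorm_ge0 V (v : V) : 0 <= vnorm v. Proof. exact: normr_ge0. Qed.
Lemma vnorm0 V : vnorm (0 : V) = 0. Proof. by rewrite /vnorm linear0 normr0. Qed.
Lemma vnormD V (u v : V) : vnorm (u + v) <= vnorm u + vnorm v.
Proof. by rewrite /vnorm linearD ler_normD. Qed.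
Lemma vnormN V (v : V) : vnorm (- v) = vnorm v.
Proof. by rewrite /vnorm linearN normrN. Qed.
Lemma vnormBC V (u v : V) : vnorm (u - v) = vnorm (v - u).
Proof. by rewrite -vnormN opprB. Qed.
Lemma vnormB V (u v : V) : vnorm (u - v) <= vnorm u + vnorm v.
Proof. by rewrite (le_trans (vnormD _ _)) // vnormN. Qed.
Lemma vnormZ V c (v : V) : vnorm (c *: v) = `|c| * vnorm v.
Proof. by rewrite /vnorm linearZ /= normrZ. Qed.
Lemma vnorm_eq0 V (v : V) : vnorm v = 0 -> v = 0.
Proof. by move/normr0_eq0 => v0; apply: v2r_inj; rewrite v0 linear0. Qed.

Lemma vnorm_sum V I (r : seq I) (P : pred I) (u : I -> V) :
  vnorm (\sum_(i <- r | P i) u i) <= \sum_(i <- r | P i) vnorm (u i).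
Proof.
elim/big_rec2: _ => [|i a v _ va]; first by rewrite vnorm0.
by rewrite (le_trans (vnormD _ _)) // lerD2l.
Qed.

Lemma coord_le_vnorm V (v : V) i : `|v2r v 0 i| <= vnorm v.
Proof.
rewrite /vnorm /Num.norm /= mx_normrE.
by apply: (le_bigmax _ (fun ij => `|v2r v ij.1 ij.2|) (0, i)).
Qed.

Lemma bilinear_bounded U V W (f : U -> V -> W) :
  (forall x, linear (f x)) -> (forall y, linear (f^~ y)) ->
  exists2 K, 0 < K & forall u v, vnorm (f u v) <= K * vnorm u * vnorm v.
Proof.
move=> fr fl; pose e i : U := r2v (delta_mx 0 i); pose g i : V := r2v (delta_mx 0 i).
pose K : R := \sum_i \sum_j vnorm (f (e i) (g j)).
have K0 : 0 <= K by apply: sumr_ge0 => i _; apply: sumr_ge0 => j _; apply: vnorm_ge0.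
exists (K + 1) => [|u v]; first by rewrite ltr_wpDl.
have fE : f u v = \sum_i \sum_j (v2r u 0 i * v2r v 0 j) *: f (e i) (g j).
  rewrite {1}[u]vect_sum (linear_fun_sum _ _ _ (fl v)); apply: eq_bigr => i _.
  rewrite {1}[v]vect_sum (linear_fun_sum _ _ _ (fr (e i))) scaler_sumr.
  by apply: eq_bigr => j _; rewrite scalerA.
have le1 : vnorm (f u v) <= K * vnorm u * vnorm v.
  rewrite fE (le_trans (vnorm_sum _ _ _)) // /K !mulr_suml ler_sum // => i _.
  rewrite (le_trans (vnorm_sum _ _ _)) // !mulr_suml ler_sum // => j _.
  rewrite vnormZ normrM mulrC -mulrA ler_wpM2l ?vnorm_ge0 //.
  by rewrite ler_pM ?coord_le_vnorm.
by rewrite (le_trans le1) // -!mulrA ler_wpM2r ?mulr_ge0 ?vnorm_ge0 // lerDl.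
Qed.

Lemma linear_bounded V W (f : V -> W) : linear f ->
  exists2 K, 0 < K & forall v, vnorm (f v) <= K * vnorm v.
Proof.
move=> fl; have [|| K K0 Kf] := @bilinear_bounded R^o V W (fun c v => c *: f v).
- by move=> c a u v; rewrite fl scalerDr !scalerA mulrC.
- by move=> v a c d; rewrite scalerDl scalerA.
exists (K * vnorm (1 : R^o) + 1); first by rewrite ltr_wpDl ?mulr_ge0 ?vnorm_ge0 // ltW.
move=> v; have := Kf 1 v; rewrite scale1r => /le_trans-> //.
by rewrite ler_wpM2r ?vnorm_ge0 // lerDl.
Qed.

End Norm.

Section Convergence.
Variable R : realType.
Implicit Types U V W : vectType R.

(** Convergence for the coordinate norm; [euclidean_cvgP] identifies it with
    convergence for the topology of [euclidean]. *)
Definition cvgv V (u : nat -> V) (l : V) := vnorm (u n - l) @[n --> \oo] --> (0 : R).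

Lemma cvgvP V (u : nat -> V) l :
  cvgv u l <-> (v2r (u n) @[n --> \oo] --> v2r l).
Proof.
split=> /cvgrPdistC_lt ul; apply/cvgrPdistC_lt => e /ul; apply: filterS => n.
  by rewrite subr0 ger0_norm ?vnorm_ge0 // /vnorm linearB.
by rewrite subr0 ger0_norm ?vnorm_ge0 // /vnorm linearB.
Qed.

Lemma cvgv_unique V (u : nat -> V) l m : cvgv u l -> cvgv u m -> l = m.
Proof.
move=> /cvgvP ul /cvgvP um; apply: v2r_inj.
exact: (cvg_unique _ ul um).
Qed.

Lemma cvgv_squeeze V (u : nat -> V) l (c : nat -> R) :
  (forall n, vnorm (u n - l) <= c n) -> c @ \oo --> (0 : R) -> cvgv u l.
Proof.
move=> uc c0; apply: (squeeze_cvgr _ (cvg_cst 0) c0).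
by apply: nearW => n; rewrite vnorm_ge0 uc.
Qed.

Lemma cvgv_linear V W (f : V -> W) u l : linear f -> cvgv u l ->
  cvgv (fun n => f (u n)) (f l).
Proof.
move=> fl ul; have [K K0 fK] := linear_bounded fl.
apply: (@cvgv_squeeze _ _ _ (fun n => K * vnorm (u n - l))) => [n|].
  by rewrite -(linear_funB fl).
by rewrite -(mulr0 K); apply: cvgM => //; apply: cvg_cst.
Qed.

Lemma cvgvD V (u v : nat -> V) l m : cvgv u l -> cvgv v m ->
  cvgv (fun n => u n + v n) (l + m).
Proof.
move=> ul vm; apply: (@cvgv_squeeze _ _ _ (fun n => vnorm (u n - l) + vnorm (v n - m))) => [n|].
  by rewrite opprD addrACA vnormD.
by rewrite -(addr0 0); apply: cvgD.
Qed.

Lemma cvgv_bilinear U V W (f : U -> V -> W) u v l m :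
  (forall x, linear (f x)) -> (forall y, linear (f^~ y)) ->
  cvgv u l -> cvgv v m -> cvgv (fun n => f (u n) (v n)) (f l m).
Proof.
move=> fr fl ul vm; have [K K0 fK] := bilinear_bounded fr fl.
apply: (@cvgv_squeeze _ _ _ (fun n => K * vnorm (u n - l) * vnorm (v n - m)
   + K * vnorm (u n - l) * vnorm m + K * vnorm l * vnorm (v n - m))) => [n|].
  have -> : f (u n) (v n) - f l m
    = f (u n - l) (v n - m) + f (u n - l) m + f l (v n - m).
    by rewrite !(linear_funB (fr _)) !(linear_funB (fl _)); vring.
  apply: (le_trans (vnormD _ _)); apply: lerD => //.
  by apply: (le_trans (vnormD _ _)); apply: lerD.
rewrite -[X in _ --> X](_ : K * 0 * 0 + K * 0 * vnorm m + K * vnorm l * 0 = 0); last by ring.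
by apply: cvgD; [apply: cvgD|]; apply: cvgM => //; try apply: cvg_cst; apply: cvgM => //; apply: cvg_cst.
Qed.

Lemma cvgv_le V (u : nat -> V) l c m : cvgv u l ->
  (forall n, (m <= n)%N -> vnorm (u n) <= c) -> vnorm l <= c.
Proof.
move=> ul uc; rewrite leNgt; apply/negP => cl.
have /cvgrPdistC_lt/(_ (vnorm l - c)) := ul; rewrite subr_gt0 => /(_ cl)[N _ NP].
have /= := NP (maxn N m) (leq_maxl _ _); set n := maxn N m.
rewrite subr0 ger0_norm ?vnorm_ge0 // vnormBC => un.
have := vnormD (l - u n) (u n); rewrite subrK => /le_lt_trans.
by move/(_ _ (ltr_leD un (uc n (leq_maxr _ _)))); rewrite subrK ltxx.
Qed.

Lemma summable_cvgv V (u : nat -> V) (c : nat -> R) :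
  (forall n, vnorm (u n) <= c n) -> cvgn (series c) ->
  exists l, cvgv (fun n => \sum_(k < n) u k) l.
Proof.
move=> uc cc.
have : cvgn (series (fun n => v2r (u n))).
  apply: normed_cvg; apply: (series_le_cvg _ _ uc cc) => n; first exact: vnorm_ge0.
  exact: le_trans (vnorm_ge0 _) (uc n).
move=> cu; exists (r2v (limn (series (fun n => v2r (u n))))).
apply/cvgvP; rewrite r2vK; suff -> : (fun n => v2r (\sum_(k < n) u k)) = series (fun n => v2r (u n)) by exact: cu.
by apply/funext => n; rewrite /series /= big_mkord linear_sum.
Qed.

End Convergence.

(** * The operator exponential *)

Section EuclideanTopology.
Variable R : realType.
Implicit Types V : vectType R.

Lemma euclidean_cvgP V (u : nat -> euclidean V) (l : V) :
  (u @ \oo --> (l : euclidean V)) <-> cvgv (u : nat -> V) l.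
Proof.
split=> [ul|/cvgvP ul].
  apply/cvgvP.
  exact: (cvg_comp _ _ ul (@initial_continuous V 'rV[R]_(dim V) (@v2r R V) l)).
move=> B [_ [[A Aop <-] Al AB]].
have nA : nbhs (v2r l) A by exact: (open_nbhs_nbhs (conj Aop Al)).
by have [N _ NA] := ul _ nA; exists N => // n Nn; apply/AB/NA.
Qed.

Lemma euclidean_ball_open V (x : V) (e : R) :
  open ([set y | vnorm (y - x) < e] : set (euclidean V)).
Proof.
exists [set z : 'rV[R]_(dim V) | `|z - v2r x| < e]; last first.
  by apply/seteqP; split=> y /=; rewrite /vnorm linearB.
have -> : [set z : 'rV[R]_(dim V) | `|z - v2r x| < e] = ball (v2r x) e.
  by apply/seteqP; split=> z /=; rewrite -ball_normE /= distrC.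
exact: ball_open.
Qed.

End EuclideanTopology.

Section OperatorExponential.
Variable R : realType.
Implicit Types V W : vectType R.

Definition lpow V (T : 'End(V)) k : 'End(V) :=
  iter k (fun S => (T \o S)%VF) \1%VF.

Lemma lpowE V (T : 'End(V)) k v : lpow T k v = iter k T v.
Proof. by elim: k => [|k IHk]; rewrite ?id_lfunE // /lpow iterS comp_lfunE IHk. Qed.

Lemma comp_bounded V : exists2 K : R, 0 < K &
  forall S T : 'End(V), vnorm (S \o T)%VF <= K * vnorm S * vnorm T.
Proof.
apply: bilinear_bounded => [S|T] c u v.
  by rewrite comp_lfunDr -comp_lfunZr.
by rewrite comp_lfunDl -comp_lfunZl.
Qed.

Lemma lpow_bounded V (K : R) (T : 'End(V)) k : 0 < K ->
  (forall S T : 'End(V), vnorm (S \o T)%VF <= K * vnorm S * vnorm T) ->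
  vnorm (lpow T k) <= (K * vnorm T) ^+ k * vnorm (\1%VF : 'End(V)).
Proof.
move=> K0 KP; elim: k => [|k IHk]; first by rewrite mul1r.
rewrite [lpow T k.+1]/(T \o lpow T k)%VF (le_trans (KP _ _)) // exprS -[leRHS]mulrA.
by rewrite ler_wpM2l // mulr_ge0 ?vnorm_ge0 // ltW.
Qed.

Lemma exp_partialE V (T : 'End(V)) N :
  exp_partial T N = \sum_(k < N) k`!%:R^-1 *: lpow T k.
Proof. by []. Qed.

Lemma exp_cvgv V (T : 'End(V)) :
  cvgv (exp_partial T : nat -> 'End(V)) (exp_end T).
Proof.
have [K K0 KP] := comp_bounded V.
have [||l lP] := @summable_cvgv R 'End(V)
    (fun k => k`!%:R^-1 *: lpow T k)
    (fun k => exp_coeff (K * vnorm T) k * vnorm (\1%VF : 'End(V))).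
- move=> k; rewrite vnormZ ger0_norm ?invr_ge0 // /exp_coeff /= mulrAC [leRHS]mulrC.
  by rewrite ler_wpM2l ?invr_ge0 // lpow_bounded.
- have -> : series (fun k => exp_coeff (K * vnorm T) k * vnorm (\1%VF : 'End(V)))
      = (fun n => series (exp_coeff (K * vnorm T)) n * vnorm (\1%VF : 'End(V))).
    by apply/funext => n; rewrite /series /= mulr_suml.
  by apply: is_cvgM; [exact: is_cvg_series_exp_coeff|exact: is_cvg_cst].
apply: (euclidean_cvgP (exp_partial T) (exp_end T)).1.
have lP' := (euclidean_cvgP (exp_partial T) l).2 lP.
have : cvg (exp_partial T @ \oo) by apply: cvgP lP'.
exact.
Qed.

(** The common form of all the comparisons between exponentials of two related
    operators: an identity between powers, up to linear maps, passes to the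
    limit. *)
Lemma exp_transfer V W (U : vectType R) (A : 'End(V)) (B : 'End(W)) (f : 'End(V) -> U)
    (g : W -> U) w : linear f -> linear g ->
  (forall k, f (lpow A k) = g (lpow B k w)) -> f (exp_end A) = g (exp_end B w).
Proof.
move=> fl gl fg; apply: (@cvgv_unique _ _ (fun N => f (exp_partial A N))).
  exact: cvgv_linear (exp_cvgv A).
have -> : (fun N => f (exp_partial A N)) = (fun N => g (exp_partial B N w)).
  apply/funext => N; rewrite !exp_partialE sum_lfunE linear_fun_sum //.
  under [in RHS]eq_bigr => k _ do rewrite scale_lfunE.
  by rewrite linear_fun_sum //; apply: eq_bigr => k _; rewrite fg.
apply: (@cvgv_linear _ _ _ (fun T : 'End(W) => g (T w))) (exp_cvgv B) => c S T.
by rewrite add_lfunE scale_lfunE gl.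
Qed.

Lemma exp_intertwine V W (A : 'End(V)) (B : 'End(W)) (f : V -> W) : linear f ->
  (forall v, f (A v) = B (f v)) -> forall v, f (exp_end A v) = exp_end B (f v).
Proof.
move=> fl fAB v; apply: (@exp_transfer _ _ _ A B (fun T => f (T v)) id (f v)) => //.
  by move=> c S T; rewrite add_lfunE scale_lfunE fl.
by move=> k; rewrite !lpowE; elim: k => // k IHk; rewrite !iterS fAB IHk.
Qed.

Lemma exp0 V : exp_end (0 : 'End(V)) = \1%VF.
Proof.
apply: (cvgv_unique (exp_cvgv 0)).
apply: (@cvgv_squeeze _ _ _ _ (fun N => (N == 0%N)%:R * vnorm (\1%VF : 'End(V)))) => [N|].
  case: N => [|N]; first by rewrite exp_partialE big_ord0 sub0r vnormN mul1r.
  rewrite mul0r exp_partialE big_ord_recl big1 => [|k _]; last first.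
    have -> : lpow 0 (lift ord0 k) = 0 :> 'End(V).
      by apply/lfunP => v; rewrite [lpow _ _]/(0 \o lpow 0 k)%VF comp_lfunE !zero_lfunE.
    by rewrite scaler0.
  by rewrite fact0 invr1 scale1r addr0 [lpow 0 0]/(\1%VF) subrr vnorm0.
apply/cvgrPdistC_lt => e e0; exists 1%N => // -[//|n] _ /=.
by rewrite mul0r subrr normr0.
Qed.

Lemma triangle_sum (Z : zmodType) (F : nat -> nat -> Z) N :
  \sum_(n < N) \sum_(i < n.+1) F i (n - i)%N
  = \sum_(i < N) \sum_(j < N - i) F i j.
Proof.
elim: N => [|N IHN]; first by rewrite !big_ord0.
rewrite big_ord_recr IHN /= [RHS]big_ord_recr /= subSnn big_ord1.
rewrite [\sum_(i < N.+1) _]big_ord_recr /= subnn addrA; congr (_ + _).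
rewrite -big_split; apply: eq_bigr => i _ /=.
by rewrite subSn ?big_ord_recr // ltnW.
Qed.

(** The terms that separate the product of two partial sums from the partial
    sum of the Cauchy product. *)
Lemma box_minus_triangle (Z : zmodType) (F : nat -> nat -> Z) N :
  \sum_(i < N) \sum_(j < N) F i j - \sum_(n < N) \sum_(i < n.+1) F i (n - i)%N
  = \sum_(i < N) \sum_(N - i <= j < N) F i j.
Proof.
rewrite triangle_sum -sumrB; apply: eq_bigr => i _.
rewrite -!(big_mkord xpredT (F i)) (big_cat_nat (n := (N - i)%N)) ?leq_subr //=.
by rewrite addrAC subrr add0r.
Qed.

Lemma f2mx_lpow V (T : 'End(V)) k : f2mx (lpow T k) = f2mx T ^+ k.
Proof.
elim: k => [|k IHk]; last by rewrite exprSr -IHk; apply: f2mx_comp.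
rewrite expr0; apply/row_matrixP => i; rewrite !rowE mulmx1.
by rewrite -[delta_mx 0 i]r2vK -v2r_lfun id_lfunE.
Qed.

Definition expterm V (T : 'End(V)) k : 'End(V) := k`!%:R^-1 *: lpow T k.

Lemma expterm_add V (S T : 'End(V)) n : (S \o T = T \o S)%VF ->
  expterm (S + T) n = \sum_(i < n.+1) (expterm S i \o expterm T (n - i))%VF.
Proof.
move=> ST; rewrite /expterm.
have f2mx_inj : injective (@f2mx R V V) by move=> [A] [B] /= ->.
have f2mx_sum I (r : seq I) (u : I -> 'End(V)) :
    f2mx (\sum_(i <- r) u i) = \sum_(i <- r) f2mx (u i).
  elim: r => [|i r IHr]; last by rewrite !big_cons -[u i]scale1r f2mxP IHr !scale1r.
  rewrite !big_nil; apply/row_matrixP => i; rewrite !rowE mulmx0.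
  by rewrite -[delta_mx 0 i]r2vK -v2r_lfun zero_lfunE linear0.
have f2mxZ c (A : 'End(V)) : f2mx (c *: A) = c *: f2mx A.
  have z0 : f2mx (0 : 'End(V)) = 0 by have := f2mx_sum 'I_0 [::] (fun=> 0); rewrite !big_nil.
  by rewrite -[c *: A]addr0 f2mxP z0 addr0.
apply: f2mx_inj; rewrite f2mxZ f2mx_sum f2mx_lpow -[S]scale1r f2mxP !scale1r.
rewrite addrC exprDn_comm; last by rewrite /GRing.comm -[LHS]f2mx_comp ST f2mx_comp.
rewrite scaler_sumr; apply: eq_bigr => i _.
have iN : (i <= n)%N by rewrite -ltnS.
rewrite f2mx_comp !f2mxZ !f2mx_lpow -scalemxAl -scalemxAr scalerA.
rewrite -scalerMnr scalerMnl -mulr_natr; congr (_ *: _).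
have fact0' k : k`!%:R != 0 :> R by rewrite pnatr_eq0 -lt0n fact_gt0.
by rewrite -(bin_fact iN) !natrM; field; rewrite !fact0' /= pnatr_eq0 -lt0n bin_gt0.
Qed.

(** The terms of the difference of partial sums are bounded by the
    corresponding real terms for the norms, and these tend to zero because of
    the functional equation of the real exponential. *)
Theorem expD V (S T : 'End(V)) : (S \o T = T \o S)%VF ->
  exp_end (S + T) = (exp_end S \o exp_end T)%VF.
Proof.
move=> ST; have [K K0 KP] := comp_bounded V.
pose s := K * vnorm S; pose t := K * vnorm T; pose c := vnorm (\1%VF : 'End(V)).
pose e (x : R) k := x ^+ k / k`!%:R.
have e_ge0 x k : 0 <= x -> 0 <= e x k by move=> x0; rewrite divr_ge0 ?exprn_ge0.
have s0 : 0 <= s by rewrite mulr_ge0 ?vnorm_ge0 // ltW.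
have t0 : 0 <= t by rewrite mulr_ge0 ?vnorm_ge0 // ltW.
have expterm_le (A : 'End(V)) k : vnorm (expterm A k) <= e (K * vnorm A) k * c.
  rewrite vnormZ ger0_norm ?invr_ge0 // /e mulrAC [leRHS]mulrC.
  by rewrite ler_wpM2l ?invr_ge0 // lpow_bounded.
have exp_eD n : e (s + t) n = \sum_(i < n.+1) e s i * e t (n - i)%N.
  rewrite /e addrC exprDn mulr_suml; apply: eq_bigr => i _.
  have iN : (i <= n)%N by rewrite -ltnS.
  have fact0' k : k`!%:R != 0 :> R by rewrite pnatr_eq0 -lt0n fact_gt0.
  rewrite -(bin_fact iN) !natrM -mulr_natr; field.
  by rewrite !fact0' /= pnatr_eq0 -lt0n bin_gt0.
pose a N : R := series (e s) N * series (e t) N - series (e (s + t)) N.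
have a0 : a @ \oo --> (0 : R).
  have -> : 0 = expR s * expR t - expR (s + t) :> R by rewrite expRD subrr.
  by apply: cvgB; [apply: cvgM|]; apply: is_cvg_series_exp_coeff.
apply: (cvgv_unique (exp_cvgv (S + T))).
have compE : cvgv (fun N => (exp_partial S N \o exp_partial T N)%VF : 'End(V))
    (exp_end S \o exp_end T)%VF.
  apply: (cvgv_bilinear (f := fun A B : 'End(V) => (A \o B)%VF)); try exact: exp_cvgv.
    by move=> A x u v; rewrite comp_lfunDr -comp_lfunZr.
  by move=> A x u v; rewrite comp_lfunDl -comp_lfunZl.
have diff0 : cvgv (fun N => exp_partial (S + T) N - (exp_partial S N \o exp_partial T N)%VF : 'End(V)) 0.
  apply: (@cvgv_squeeze _ _ _ _ (fun N => (K * c * c) * a N)) => [N|]; last first.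
    by rewrite -(mulr0 (K * c * c)); apply: cvgM => //; apply: cvg_cst.
  rewrite subr0 vnormBC.
  have -> : (exp_partial S N \o exp_partial T N)%VF - exp_partial (S + T) N
     = \sum_(i < N) \sum_(N - i <= j < N) (expterm S i \o expterm T j)%VF.
    rewrite -(box_minus_triangle (fun i j => (expterm S i \o expterm T j)%VF)); congr (_ - _).
      apply/lfunP => v; rewrite comp_lfunE !sum_lfunE; apply: eq_bigr => i _.
      rewrite !sum_lfunE linear_sum; apply: eq_bigr => j _.
      by rewrite comp_lfunE.
    by apply: eq_bigr => n _; apply: expterm_add.
  have -> : a N = \sum_(i < N) \sum_(N - i <= j < N) e s i * e t j.
    rewrite -(box_minus_triangle (fun i j => e s i * e t j)) /a /series /= !big_mkord; congr (_ - _).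
      by rewrite mulr_suml; apply: eq_bigr => i _; rewrite mulr_sumr.
    by apply: eq_bigr => n _; apply: exp_eD.
  rewrite (le_trans (vnorm_sum _ _ _)) // mulr_sumr ler_sum // => i _.
  rewrite (le_trans (vnorm_sum _ _ _)) // mulr_sumr ler_sum // => j _.
  rewrite (le_trans (KP _ _)) //.
  have -> : K * c * c * (e s i * e t j) = K * (e s i * c) * (e t j * c) by ring.
  rewrite ler_pM ?mulr_ge0 ?vnorm_ge0 ?ler_wpM2l ?expterm_le // ltW //.
have := cvgvD diff0 compE; rewrite add0r.
by under eq_fun => N do rewrite subrK.
Qed.

Lemma exp_Nl V (T : 'End(V)) : (exp_end (- T) \o exp_end T = \1)%VF.
Proof. by rewrite -expD ?addNr ?exp0 // comp_lfunNl comp_lfunNr. Qed.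

Lemma expNK V (T : 'End(V)) v : exp_end (- T) (exp_end T v) = v.
Proof. by rewrite -comp_lfunE exp_Nl id_lfunE. Qed.

Lemma expKN V (T : 'End(V)) v : exp_end T (exp_end (- T) v) = v.
Proof. by have := expNK (- T) v; rewrite opprK. Qed.

(** The k-th powers differ by at most k r^(k-1) |A - B| up to a constant, so
    the terms of degree at least 2 contribute at most a multiple of r. *)
Lemma exp_strict_differentiable V (eps : R) : 0 < eps -> exists2 r, 0 < r &
  forall A B : 'End(V), vnorm A <= r -> vnorm B <= r ->
  vnorm (exp_end A - exp_end B - (A - B)) <= eps * vnorm (A - B).
Proof.
move=> eps0; have [K K0 KP] := comp_bounded V.
pose c := vnorm (\1%VF : 'End(V)); pose d := K * c * expR 1 + 1.
have c0 : 0 <= c by apply: vnorm_ge0.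
have d0 : 0 < d by rewrite ltr_wpDl // !mulr_ge0 ?expR_ge0 // ltW.
(* q bounds the operators in the rescaled norm K |.|, which is
   submultiplicative. *)
pose q := Num.min 1 (eps / d).
have q0 : 0 < q by rewrite lt_min ltr01 divr_gt0.
exists (q / K); first by rewrite divr_gt0.
move=> A B; rewrite !ler_pdivlMr // ![_ * K]mulrC => Aq Bq.
set M := K * c * vnorm (A - B); have M0 : 0 <= M by rewrite !mulr_ge0 ?vnorm_ge0 // ltW.
have powB k : vnorm (lpow A k.+1 - lpow B k.+1) <= k.+1%:R * q ^+ k * M.
  elim: k => [|k IHk].
    rewrite expr0 !mul1r /lpow /= !comp_lfun1r.
    by rewrite -{1}[A - B]comp_lfun1r (le_trans (KP _ _)) // /M mulrAC.
  have -> : lpow A k.+2 - lpow B k.+2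
      = (A \o (lpow A k.+1 - lpow B k.+1))%VF + ((A - B) \o lpow B k.+1)%VF.
    by rewrite comp_lfunDr comp_lfunNr comp_lfunDl comp_lfunNl addrA subrK.
  have -> : k.+2%:R * q ^+ k.+1 * M
      = q * (k.+1%:R * q ^+ k * M) + K * vnorm (A - B) * (q ^+ k.+1 * c).
    by rewrite exprS /M [k.+2%:R]mulrS; ring.
  apply: (le_trans (vnormD _ _)); apply: lerD; apply: (le_trans (KP _ _)).
    by rewrite ler_pM ?mulr_ge0 ?vnorm_ge0 // ltW.
  rewrite ler_wpM2l ?mulr_ge0 ?vnorm_ge0 //; first exact: ltW.
  rewrite (le_trans (lpow_bounded _ _ K0 KP)) // ler_wpM2r //.
  by rewrite lerXn2r ?nnegrE ?mulr_ge0 ?vnorm_ge0 // ltW.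
apply: (@cvgv_le _ _ (fun N => exp_partial A N - exp_partial B N - (A - B)) _ _ 2).
  have cst : cvgv (fun=> - (A - B)) (- (A - B)).
    by rewrite /cvgv; under eq_fun => N do rewrite subrr vnorm0; apply: cvg_cst.
  apply: cvgvD cst; apply: cvgvD; first exact: exp_cvgv.
  apply: (@cvgv_linear _ _ _ (fun T : 'End(V) => - T)) (exp_cvgv B) => x u v.
  by rewrite opprD scalerN.
move=> [//|[//|N]] _.
have -> : exp_partial A N.+2 - exp_partial B N.+2 - (A - B)
    = \sum_(k < N) (k.+2)`!%:R^-1 *: (lpow A k.+2 - lpow B k.+2).
  rewrite !exp_partialE -sumrB !big_ord_recl /= subrr add0r.
  rewrite /lpow /= !comp_lfun1r !invr1 !scale1r addrC addKr.
  by apply: eq_bigr => k _; rewrite scalerBr.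
have sum_le : \sum_(k < N) (k.+1)`!%:R^-1 <= expR 1 :> R.
  have nd : nondecreasing_seq (series (exp_coeff (1 : R))).
    apply/nondecreasing_seqP => n; rewrite -subr_ge0 /series /= big_nat_recr //=.
    by rewrite addrAC subrr add0r /exp_coeff /= expr1n mul1r invr_ge0.
  apply: le_trans (nondecreasing_cvgn_le nd (is_cvg_series_exp_coeff (1 : R)) N.+1).
  rewrite /series /= big_mkord big_ord_recl /exp_coeff /= -[leLHS]add0r; apply: lerD.
    by rewrite divr_ge0.
  by rewrite ler_sum // => k _; rewrite expr1n mul1r.
apply: (@le_trans _ _ (q * M * \sum_(k < N) (k.+1)`!%:R^-1)).
  rewrite (le_trans (vnorm_sum _ _ _)) // mulr_sumr ler_sum // => k _.
  rewrite vnormZ ger0_norm ?invr_ge0 // factS natrM invfM.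
  have -> : q * M / (k.+1)`!%:R = k.+2%:R^-1 * (k.+1)`!%:R^-1 * (k.+2%:R * q * M).
    by rewrite -[k.+2%:R * _ * _]mulrA mulrACA mulVf ?pnatr_eq0 // mul1r mulrC.
  rewrite ler_wpM2l ?mulr_ge0 ?invr_ge0 // (le_trans (powB _)) //.
  rewrite ler_wpM2r // ler_wpM2l // exprS -[leRHS]mulr1 ler_wpM2l ?(ltW q0) //.
  by rewrite exprn_ile1 ?(ltW q0) // ge_min lexx.
apply: (@le_trans _ _ (q * d * vnorm (A - B))); last first.
  by rewrite ler_wpM2r ?vnorm_ge0 // -ler_pdivlMr // ge_min lexx orbT.
rewrite -[q * M * _]mulrA -[q * d * _]mulrA ler_wpM2l ?(ltW q0) //.
have -> : d * vnorm (A - B) = M * expR 1 + vnorm (A - B) by rewrite /d /M; ring.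
by rewrite (le_trans (ler_wpM2l M0 sum_le)) // lerDl vnorm_ge0.
Qed.

End OperatorExponential.

(** * Points of a variety near an orbit *)

Section Rigidity.
Variable R : realType.
Implicit Types V : vectType R.

(** y |-> y - F(y) is a contraction of the ball of radius r into itself. *)
Lemma local_zero V (F : V -> V) (r : R) : 0 <= r ->
  (forall y z, vnorm y <= r -> vnorm z <= r ->
     vnorm (F y - F z - (y - z)) <= 2^-1 * vnorm (y - z)) ->
  vnorm (F 0) <= r / 2 -> exists2 y, vnorm y <= r & F y = 0.
Proof.
move=> r0 Fcontr F0.
pose U := [set z : 'rV[R]_(dim V) | `|z| <= r].
pose g (z : 'rV[R]_(dim V)) := z - v2r (F (r2v z)).
have gE y : r2v (g (v2r y)) = y - F y by rewrite /g v2rK linearB /= !v2rK.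
have nvr z : vnorm (r2v z : V) = `|z| by rewrite /vnorm r2vK.
have glip y z : vnorm y <= r -> vnorm z <= r -> vnorm ((y - F y) - (z - F z)) <= 2^-1 * vnorm (y - z).
  move=> yr zr; rewrite vnormBC (_ : _ - _ = F y - F z - (y - z)) ?Fcontr //.
  by vring.
have gU : set_fun U U g.
  move=> z zr; rewrite /U /= -nvr -[z]r2vK gE; have := glip (r2v z) 0.
  rewrite vnorm0 nvr => /(_ zr r0); rewrite !subr0 sub0r opprK nvr.
  move=> le1; have := vnormB (r2v z - F (r2v z) + F 0) (F 0); rewrite addrK.
  move=> /le_trans; apply; rewrite (le_trans (lerD le1 F0)) //.
  have zr' : `|z| <= r := zr; move: `|z| zr' => a; lra.
pose gf := isFun.Build _ _ U U g gU.
pose g' : {fun U >-> U} := HB.pack g gf.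
have [|||z Uz zE] := @banach_fixed_point R 'rV[R]_(dim V) U g'.
- have half_ge0 : 0 <= 2^-1 :> R by rewrite invr_ge0.
  exists (NngNum half_ge0); split => /=; first by lra.
  move=> [z1 z2] [/= U1 U2]; have := glip (r2v z1) (r2v z2).
  by rewrite -!gE !r2vK -linearB !nvr -linearB nvr; apply.
- rewrite (_ : U = Num.norm @^-1` [set x | x <= r]) //.
  by apply: closed_comp => [x _|]; [exact: norm_continuous|exact: closed_le].
- by exists 0; rewrite /U /= normr0.
exists (r2v z); first by rewrite nvr.
move: zE; rewrite /= /g => /eqP; rewrite -subr_eq0 opprB addrCA subrr addr0 => /eqP v0.
by apply: v2r_inj; rewrite v0 linear0.
Qed.

Lemma eval_bounded V : exists2 K : R, 0 < K &
  forall (T : 'End(V)) v, vnorm (T v) <= K * vnorm T * vnorm v.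
Proof.
apply: (@bilinear_bounded _ _ _ _ (fun (T : 'End(V)) v => T v)) => [T|v] c x y.
  exact: linearP.
by rewrite add_lfunE scale_lfunE.
Qed.

(** The deviation of (x, s) |-> exp(rho x) (p + s) from its linear part, split
    into pieces that are each small: A, B stand for the rho(x), and S, T for
    their exponentials. *)
Lemma orbit_map_increment V (S T A B : 'End(V)) (p u v q : V) :
  T (p + u) - q - (S (p + v) - q) - (A p + u - (B p + v))
  = (T - S - (A - B)) p + ((T - S) u + (S - \1%VF) (u - v)).
Proof.
rewrite !(add_lfunE, opp_lfunE) id_lfunE [T (p + u)]linearD [S (p + v)]linearD.
by rewrite [S (u - v)]linearB /=; vring.
Qed.

(** [pr] projects onto the tangent vectors rho(x) p, [pi] onto a complement,
    and [al] picks x from its tangent vector, so that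
    y |-> exp(rho (al y)) (p + pi y) has the identity as derivative at 0.
    Solving for q gives the slice coordinate s = pi y, for which p + s is in
    A; [d1] is injective on the complement and quadratically small at s, so
    s = 0. *)
Theorem rigidity (X Y Z : vectType R) (rho : 'Hom(X, 'End(Y))) (p : Y)
    (A : set Y) (d1 : 'Hom(Y, Z)) (C : R) :
  (forall x y, A y -> A (exp_end (rho x) y)) ->
  (forall s, A (p + s) -> vnorm (d1 s) <= C * vnorm s ^+ 2) ->
  (forall s, d1 s = 0 -> exists x, s = rho x p) ->
  forall delta, 0 < delta -> exists2 eta, 0 < eta & forall q, A q -> vnorm (q - p) < eta ->
    exists2 x, vnorm x < delta & q = exp_end (rho x) p.
Proof.
move=> Aexp Ad1 exact1 delta delta0.
pose d0 : 'Hom(X, Y) := linfun (fun x => rho x p).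
have d0E x : d0 x = rho x p.
  by rewrite linfunE // => c u v; rewrite bilDl bilZl.
pose pr := projv (limg d0); pose pi y := y - pr y; pose al := (d0^-1 \o pr)%VF.
have d0al y : rho (al y) p = pr y.
  by rewrite -d0E comp_lfunE limg_lfunVK // memv_proj.
have piP : linear pi by move=> c u v; rewrite /pi linearP; vring.
have pi_rho x : pi (rho x p) = 0.
  by rewrite /pi -d0E [pr _]projv_id ?subrr // memv_img ?memvf.
have pipi y : pi (pi y) = pi y by rewrite {2}/pi -d0al -scaleN1r addrC piP pi_rho scaler0 add0r.
have [Ke Ke0 evP] := eval_bounded Y.
have [Kp Kp0 piB] := linear_bounded piP.
have rhoalP : linear (fun y => rho (al y)) by move=> c u v; rewrite !linearP.
have [Ka Ka0 rhoB] := linear_bounded rhoalP.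
have alP : linear al by apply: linearP.
have [Kb Kb0 alB] := linear_bounded alP.
have pid1P : linear (fun z => pi (d1^-1%VF z)) by move=> c u v; rewrite linearP piP.
have [Kd Kd0 d1B] := linear_bounded pid1P.
(* With this eps the first piece of the increment has slope at most 1/4; the
   bound S^-1 on the radius r below does the same for the two others together,
   keeps the quadratic estimate contracting, and makes al y smaller than delta. *)
pose eps := Num.min 1 (4^-1 / (Ke * Ka * (vnorm p + 1))).
have p1 : 0 < vnorm p + 1 by rewrite ltr_wpDl ?vnorm_ge0.
have eps0 : 0 < eps by rewrite lt_min ltr01 !mulr_gt0 ?invr_gt0 ?mulr_gt0.
have eps1 : eps <= 1 by rewrite ge_min lexx.
have epsp : Ke * Ka * eps * vnorm p <= 4^-1.
  have : eps <= 4^-1 / (Ke * Ka * (vnorm p + 1)) by rewrite ge_min lexx orbT.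
  rewrite ler_pdivlMr ?mulr_gt0 // => /(le_trans _); apply.
  rewrite [leRHS]mulrC -!mulrA !ler_pM2l // [leRHS]mulrC ler_pM2l // lerDl //.
have [r0 r00 expP] := @exp_strict_differentiable R Y eps eps0.
pose S := 16 * Ke * Ka * Kp + 2 * Kd * (`|C| + 1) * Kp + 2 * Kb / delta.
have C1 : 0 < `|C| + 1 by rewrite ltr_wpDl.
have S1 : 0 < 16 * Ke * Ka * Kp by rewrite !mulr_gt0.
have S2 : 0 < 2 * Kd * (`|C| + 1) * Kp by rewrite !mulr_gt0.
have S3 : 0 < 2 * Kb / delta by rewrite !mulr_gt0 ?invr_gt0.
have S0 : 0 < S by rewrite !addr_gt0.
pose r := Num.min (r0 / Ka) S^-1.
have rpos : 0 < r by rewrite lt_min invr_gt0 S0 divr_gt0.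
have rKa y : vnorm y <= r -> vnorm (rho (al y)) <= r0.
  move=> yr; rewrite (le_trans (rhoB _)) // mulrC -ler_pdivlMr //.
  by rewrite (le_trans yr) // ge_min lexx.
have rS : r * S <= 1 by rewrite -ler_pdivlMr // div1r ge_min lexx orbT.
have rb a b c : 0 < a -> 0 < b -> 0 < c -> r * (a + b + c) <= 1 ->
    [/\ r * a <= 1, r * b <= 1 & r * c <= 1].
  by move=> a0 b0 c0; rewrite !mulrDr; have := mulr_gt0 rpos a0;
    have := mulr_gt0 rpos b0; have := mulr_gt0 rpos c0; split; lra.
have [rS1 rS2 rS3] := rb _ _ _ S1 S2 S3 rS.
exists (r / 2) => [|q Aq qp]; first by rewrite divr_gt0.
pose E y := exp_end (rho (al y)).
pose F y := E y (p + pi y) - q.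
have [|y z yr zr||y yr Fy] := @local_zero Y F r.
- exact: ltW.
- have -> : F y - F z - (y - z)
      = (E y - E z - (rho (al y) - rho (al z))) p + ((E y - E z) (pi y)
        + (E z - \1%VF) (pi y - pi z)).
    have yE w : w = rho (al w) p + pi w by rewrite d0al /pi addrC subrK.
    by rewrite -(orbit_map_increment _ _ _ _ _ _ _ q) -!yE.
  have linE : rho (al y) - rho (al z) = rho (al (y - z)) by rewrite !linearB.
  have le1 : vnorm (E y - E z - (rho (al y) - rho (al z))) <= eps * (Ka * vnorm (y - z)).
    rewrite (le_trans (expP _ _ (rKa y yr) (rKa z zr))) // ler_wpM2l ?(ltW eps0) //.
    by rewrite linE rhoB.
  have le2 : vnorm (E y - E z) <= 2 * (Ka * vnorm (y - z)).
    rewrite -[E y - E z](subrK (rho (al y) - rho (al z))) (le_trans (vnormD _ _)) //.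
    rewrite mulrDl mul1r lerD //; last by rewrite linE rhoB.
    by rewrite (le_trans le1) // ler_piMl // mulr_ge0 ?vnorm_ge0 // ltW.
  have le3 : vnorm (E z - \1%VF) <= 2 * (Ka * r).
    have z0 : vnorm (0 : 'End(Y)) <= r0 by rewrite vnorm0 ltW.
    have := expP _ _ (rKa z zr) z0; rewrite exp0 subr0 => ez.
    rewrite -[E z - _](subrK (rho (al z))) (le_trans (vnormD _ _)) //.
    have rz : vnorm (rho (al z)) <= Ka * r by rewrite (le_trans (rhoB _)) // ler_wpM2l // ltW.
    rewrite mulrDl mul1r lerD // (le_trans ez) // -[leRHS]mul1r.
    by rewrite ler_pM ?vnorm_ge0 // ltW.
  have le4 : vnorm (pi y) <= Kp * r by rewrite (le_trans (piB _)) // ler_wpM2l // ltW.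
  have le5 : vnorm (pi y - pi z) <= Kp * vnorm (y - z).
    by rewrite -scaleN1r addrC -piP scaleN1r addrC.
  move: (vnorm_ge0 (y - z)) le1 le2 le5; set N := vnorm (y - z) => N0 le1 le2 le5.
  have t1 : vnorm ((E y - E z - (rho (al y) - rho (al z))) p) <= Ke * (eps * (Ka * N)) * vnorm p.
    by rewrite (le_trans (evP _ _)) // ler_wpM2r ?vnorm_ge0 // ler_wpM2l // ltW.
  have t2 : vnorm ((E y - E z) (pi y)) <= Ke * (2 * (Ka * N)) * (Kp * r).
    rewrite (le_trans (evP _ _)) // ler_pM ?vnorm_ge0 ?mulr_ge0 ?vnorm_ge0 ?ler_wpM2l // ltW //.
  have t3 : vnorm ((E z - \1%VF) (pi y - pi z)) <= Ke * (2 * (Ka * r)) * (Kp * N).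
    rewrite (le_trans (evP _ _)) // ler_pM ?vnorm_ge0 ?mulr_ge0 ?vnorm_ge0 ?ler_wpM2l // ltW //.
  rewrite (le_trans (vnormD _ _)) // (le_trans (lerD t1 (vnormD _ _))) //.
  rewrite (le_trans (lerD (lexx _) (lerD t2 t3))) //.
  have -> : Ke * (eps * (Ka * N)) * vnorm p + (Ke * (2 * (Ka * N)) * (Kp * r) +
     Ke * (2 * (Ka * r)) * (Kp * N)) = (Ke * Ka * eps * vnorm p + 4^-1 * (r * (16 * Ke * Ka * Kp))) * N.
    by field.
  rewrite ler_wpM2r //; move: rS1 epsp; set a := r * _; set b := Ke * _ * _ * _; lra.
- rewrite /F (_ : pi 0 = 0) ?addr0; last by rewrite /pi linear0 subrr.
  by rewrite /E !linear0 exp0 id_lfunE vnormBC ltW.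
have qE : q = exp_end (rho (al y)) (p + pi y).
  by apply/esym/eqP; rewrite -subr_eq0; apply/eqP.
have pq : p + pi y = exp_end (rho (- al y)) q by rewrite qE linearN expNK.
have piy0 : pi y = 0.
  have s2 : vnorm (d1 (pi y)) <= C * vnorm (pi y) ^+ 2 by apply: Ad1; rewrite pq; apply: Aexp.
  have piE : pi (d1^-1%VF (d1 (pi y))) = pi y.
    have [x xE] : exists x, d1^-1%VF (d1 (pi y)) - pi y = rho x p.
      by apply: exact1; rewrite linearB /= limg_lfunVK ?subrr // memv_img ?memvf.
    rewrite -[d1^-1%VF _](subrK (pi y)) xE -[rho x p]scale1r piP pi_rho scaler0 add0r.
    exact: pipi.
  have le1 : vnorm (pi y) <= Kd * (C * vnorm (pi y) ^+ 2).
    by rewrite -{1}piE (le_trans (d1B _)) // ler_wpM2l // ltW.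
  have le2 : vnorm (pi y) <= Kp * r by rewrite (le_trans (piB _)) // ler_wpM2l // ltW.
  apply: vnorm_eq0; apply/eqP; rewrite eq_le vnorm_ge0 andbT leNgt; apply/negP => s0.
  move: le1; rewrite leNgt => /negP; apply.
  apply: (@le_lt_trans _ _ (Kd * ((`|C| + 1) * (vnorm (pi y) * (Kp * r))))).
    rewrite ler_wpM2l ?(ltW Kd0) // (@le_trans _ _ (`|C| * vnorm (pi y) ^+ 2)) //.
      by rewrite ler_wpM2r ?exprn_ge0 ?vnorm_ge0 // ler_norm.
    rewrite ler_pM ?exprn_ge0 ?vnorm_ge0 // ?lerDl // expr2.
    by rewrite ler_wpM2l ?vnorm_ge0.
  have -> : Kd * ((`|C| + 1) * (vnorm (pi y) * (Kp * r)))
     = 2^-1 * (r * (2 * Kd * (`|C| + 1) * Kp)) * vnorm (pi y) by field.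
  rewrite -[ltRHS]mul1r ltr_pM2r //; move: rS2; set a := r * _; lra.
exists (al y); last by rewrite qE piy0 addr0.
rewrite (le_lt_trans (alB _)) // (le_lt_trans (ler_wpM2l (ltW Kb0) yr)) //.
have : r * (2 * Kb / delta) * delta <= 1 * delta by rewrite ler_wpM2r // ltW.
rewrite !mulrA divfK ?gt_eqF // mul1r => le1.
have := mulr_gt0 rpos Kb0; move: le1; rewrite [Kb * r]mulrC [r * 2]mulrC -mulrA.
by set a := r * Kb; lra.
Qed.

End Rigidity.

(** * Linear changes of variables acting on brackets *)

Section Transport.
Variables (R : realType) (V : vectType R).
Local Notation Y := 'Hom(V, 'Hom(V, V)).
Implicit Types (a : 'End(V)) (s t nu : Y) (x y : V).

Definition bracket_op (F : Y -> V -> V -> V) : 'End(Y) :=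
  linfun (fun nu => bil (F nu)).

Lemma bracketP c s t x y : (c *: s + t) x y = c *: s x y + t x y.
Proof. by rewrite !(add_lfunE, scale_lfunE). Qed.

Lemma bracket_opE F : (forall nu x, linear (F nu x)) ->
  (forall nu y, linear (fun x => F nu x y)) ->
  (forall x y, linear (fun nu => F nu x y)) ->
  forall nu x y, bracket_op F nu x y = F nu x y.
Proof.
move=> F1 F2 F3 nu x y; rewrite /bracket_op linfunE ?bilE // => c s t.
apply/lfunP => u; apply/lfunP => v.
by rewrite bracketP !bilE // F3.
Qed.

Definition op_out a := bracket_op (fun nu x y => a (nu x y)).
Definition op_fst a := bracket_op (fun nu x y => nu (a x) y).
Definition op_snd a := bracket_op (fun nu x y => nu x (a y)).

Lemma op_outE a nu x y : op_out a nu x y = a (nu x y).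
Proof.
apply: bracket_opE => [s u|s u|u v] c w z.
- by rewrite !linearP.
- by rewrite bilDl bilZl linearP.
- by rewrite bracketP linearP.
Qed.

Lemma op_fstE a nu x y : op_fst a nu x y = nu (a x) y.
Proof.
apply: bracket_opE => [s u|s u|u v] c w z; last exact: bracketP.
- by rewrite linearP.
- by rewrite linearP bilDl bilZl.
Qed.

Lemma op_sndE a nu x y : op_snd a nu x y = nu x (a y).
Proof.
apply: bracket_opE => [s u|s u|u v] c w z; last exact: bracketP.
- by rewrite !linearP.
- by rewrite bilDl bilZl.
Qed.

Lemma opP (T S : 'End(Y)) c nu x y :
  (c *: T + S) nu x y = c *: T nu x y + S nu x y.
Proof. by rewrite (add_lfunE (c *: T)) scale_lfunE bracketP. Qed.

Lemma opB (T S : 'End(Y)) nu x y : (T - S) nu x y = T nu x y - S nu x y.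
Proof. by rewrite addrC -scaleN1r opP scaleN1r addrC. Qed.

Lemma opD (T S : 'End(Y)) nu x y : (T + S) nu x y = T nu x y + S nu x y.
Proof. by rewrite -[T]scale1r opP !scale1r. Qed.

(** The derivative at the identity of the transport of brackets. *)
Definition gl_action : 'Hom('End(V), 'End(Y)) :=
  linfun (fun a => op_out a - (op_fst a + op_snd a)).

Lemma gl_actionE a : gl_action a = op_out a - (op_fst a + op_snd a).
Proof.
have outP : linear op_out.
  move=> c a1 a2; apply/lfunP => nu; apply/lfunP => x; apply/lfunP => y.
  by rewrite opP !op_outE add_lfunE scale_lfunE.
have fstP : linear op_fst.
  move=> c a1 a2; apply/lfunP => nu; apply/lfunP => x; apply/lfunP => y.
  by rewrite opP !op_fstE (add_lfunE (c *: a1)) scale_lfunE bilDl bilZl.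
have sndP : linear op_snd.
  move=> c a1 a2; apply/lfunP => nu; apply/lfunP => x; apply/lfunP => y.
  by rewrite opP !op_sndE (add_lfunE (c *: a1)) scale_lfunE linearP.
rewrite /gl_action linfunE // => c a1 a2; rewrite outP fstP sndP.
by rewrite scalerBr scalerDr [X in _ - X]addrACA opprD addrACA.
Qed.

Lemma gl_action_apply a nu x y :
  gl_action a nu x y = a (nu x y) - (nu (a x) y + nu x (a y)).
Proof. by rewrite gl_actionE opB opD op_outE op_fstE op_sndE. Qed.

Let eval2_linear x y : linear (fun nu : Y => nu x y).
Proof. by move=> c s t; apply: bracketP. Qed.

Lemma exp_op_out a nu x y : exp_end (op_out a) nu x y = exp_end a (nu x y).
Proof.
apply/esym/(exp_transfer (f := fun T : 'End(V) => T (nu x y)) _ (eval2_linear x y)).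
  by move=> c S T; rewrite add_lfunE scale_lfunE.
move=> k; rewrite !lpowE; elim: k => // k IHk; by rewrite !iterS op_outE IHk.
Qed.

Lemma exp_op_fst a nu x y : exp_end (op_fst a) nu x y = nu (exp_end a x) y.
Proof.
apply/esym/(exp_transfer (f := fun T : 'End(V) => nu (T x) y) _ (eval2_linear x y)).
  by move=> c S T; rewrite add_lfunE scale_lfunE bilDl bilZl.
move=> k; rewrite !lpowE; elim: k x => // k IHk x; by rewrite iterSr iterS op_fstE IHk.
Qed.

Lemma exp_op_snd a nu x y : exp_end (op_snd a) nu x y = nu x (exp_end a y).
Proof.
apply/esym/(exp_transfer (f := fun T : 'End(V) => nu x (T y)) _ (eval2_linear x y)).
  by move=> c S T; rewrite add_lfunE scale_lfunE linearP.
move=> k; rewrite !lpowE; elim: k y => // k IHk y; by rewrite iterSr iterS op_sndE IHk.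
Qed.

(** The three ways in which [a] acts on a bracket commute, and the action on the
    output is the sum of [gl_action] and the two actions on the inputs. *)
Lemma exp_gl_action a nu x y :
  exp_end (gl_action a) nu (exp_end a x) (exp_end a y) = exp_end a (nu x y).
Proof.
have outE : op_out a = op_fst a + (op_snd a + gl_action a).
  by rewrite gl_actionE addrA addrC subrK.
have comm_snd : (op_snd a \o gl_action a = gl_action a \o op_snd a)%VF.
  apply/lfunP => s; apply/lfunP => u; apply/lfunP => v.
  by rewrite ![(_ \o _)%VF s]comp_lfunE op_sndE !gl_action_apply !op_sndE.
have comm_fst : (op_fst a \o (op_snd a + gl_action a)
    = (op_snd a + gl_action a) \o op_fst a)%VF.
  apply/lfunP => s; apply/lfunP => u; apply/lfunP => v.
  rewrite ![(_ \o _)%VF s]comp_lfunE op_fstE !opD !gl_action_apply.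
  by rewrite !op_sndE !op_fstE.
have e1 : exp_end (op_snd a + gl_action a) nu = exp_end (op_snd a) (exp_end (gl_action a) nu).
  by rewrite (expD comm_snd); apply: comp_lfunE.
have e2 : exp_end (op_out a) nu = exp_end (op_fst a) (exp_end (op_snd a + gl_action a) nu).
  by rewrite outE (expD comm_fst); apply: comp_lfunE.
transitivity (exp_end (op_snd a) (exp_end (gl_action a) nu) (exp_end a x) y).
  exact/esym/exp_op_snd.
transitivity (exp_end (op_fst a) (exp_end (op_snd a + gl_action a) nu) x y).
  apply: (etrans (congr1 (fun m : Y => m (exp_end a x) y) (esym e1))).
  exact/esym/exp_op_fst.
apply: (etrans (congr1 (fun m : Y => m x y) (esym e2))); exact: exp_op_out.
Qed.

End Transport.

(** * Inner automorphisms and rigidity of semisimple brackets *)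

Section Automorphisms.
Variables (R : realType) (V : vectType R) (b : 'Hom(V, 'Hom(V, V))).
Implicit Types (f h : 'End(V)) (x y : V).

Definition bracket_morphism f := forall x y, f (b x y) = b (f x) (f y).

(** A derivation is an endomorphism that annihilates the bracket under
    [gl_action], so its exponential transports the bracket to itself. *)
Lemma exp_derivation (D : 'End(V)) : (forall x y, D (b x y) = b (D x) y + b x (D y)) ->
  bracket_morphism (exp_end D).
Proof.
move=> Dder x y; rewrite -exp_gl_action.
have D0 : gl_action V D b = 0.
  apply/lfunP => u; apply/lfunP => v.
  by rewrite gl_action_apply Dder subrr !zero_lfunE.
have lin1 : linear (fun c : R^o => c *: b).
  by move=> c u v; rewrite scalerDl scalerA.
have fix1 (c : R^o) : (0 : 'End(R^o)) c *: b = gl_action V D (c *: b).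
  by rewrite zero_lfunE scale0r linearZ /= D0 scaler0.
by have := exp_intertwine lin1 fix1 1; rewrite exp0 id_lfunE scale1r => <-.
Qed.

Lemma exp_ad_morphism x : lie_bracket b -> bracket_morphism (exp_end (b x)).
Proof.
by move=> lieb; apply: exp_derivation => u v; rewrite (ad_is_rep lieb x u) lbrE subrK.
Qed.

Lemma GLP f : (forall v, f v = 0 -> v = 0) -> GL f.
Proof.
move=> f0; rewrite /GL /= -subv0; apply/subvP => v.
by rewrite memv_ker memv0 => /eqP/f0->.
Qed.

Lemma GL_exp f : GL (exp_end f).
Proof. by apply: GLP => v fv; rewrite -(expNK f v) fv linear0. Qed.

Lemma GL_VK f : GL f -> cancel (f^-1)%VF f.
Proof. exact: lker0_lfunVK. Qed.

Lemma GL_K f : GL f -> cancel f (f^-1)%VF.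
Proof. exact: lker0_lfunK. Qed.

Lemma GL_comp f h : GL f -> GL h -> GL (f \o h)%VF.
Proof.
move=> fG hG; apply: GLP => v; rewrite comp_lfunE => fh0.
by rewrite -(GL_K hG v) -(GL_K fG (h v)) fh0 !linear0.
Qed.

Lemma GL_inv f : GL f -> GL (f^-1)%VF.
Proof. by move=> fG; apply: GLP => v f0; rewrite -(GL_VK fG v) f0 linear0. Qed.

Definition automorphisms : set 'End(V) := [set f | GL f /\ bracket_morphism f].

Lemma automorphisms_subgroup : subgroup_of_GL automorphisms.
Proof.
split=> [f []//||f h [fG fb] [hG hb]|f [fG fb]].
- split; last by move=> x y; rewrite !id_lfunE.
  by apply: GLP => v; rewrite id_lfunE.
- by split=> [|x y]; [apply: GL_comp|rewrite !comp_lfunE hb fb].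
- split=> [|x y]; first exact: GL_inv.
  by apply: (can_inj (GL_K fG)); rewrite fb !(GL_VK fG).
Qed.

(** The automorphisms form a subgroup that contains the exp(ad x). *)
Lemma Inn_automorphism h : lie_bracket b -> Inn b h -> automorphisms h.
Proof.
move=> lieb /(_ automorphisms); apply; split; first exact: automorphisms_subgroup.
by move=> _ [x _ <-]; split; [apply: GL_exp|apply: exp_ad_morphism].
Qed.

Lemma Inn_exp x : Inn b (exp_end (b x)).
Proof. by move=> S [_ ]; apply; exists x. Qed.

Lemma Inn_comp f h : Inn b f -> Inn b h -> Inn b (f \o h)%VF.
Proof. by move=> fI hI S SP; case: (SP) => -[_ _ + _] _; apply; [apply: fI|apply: hI]. Qed.

Lemma Inn_inv f : Inn b f -> Inn b (f^-1)%VF.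
Proof. by move=> fI S SP; case: (SP) => -[_ _ _ +] _; apply; apply: fI. Qed.

Lemma lie_bracket_transport (nu nu' : 'Hom(V, 'Hom(V, V))) (T T' : V -> V) :
  linear T -> cancel T' T -> cancel T T' ->
  (forall x y, nu' x y = T (nu (T' x) (T' y))) -> lie_bracket nu -> lie_bracket nu'.
Proof.
move=> Tl T'K TK nuE [alt jac].
have T0 : T 0 = 0 by apply: linear_fun0.
have TD x y : T (x + y) = T x + T y by have := Tl 1 x y; rewrite !scale1r.
split=> [x|x y z]; first by rewrite nuE alt T0.
by rewrite !nuE !TK -!TD jac T0.
Qed.

End Automorphisms.

Section LocalRigidity.
Variable R : realType.

Lemma jacobi_linearizedE (V : vectType R) (mu s : 'Hom(V, 'Hom(V, V))) x y z :
  lie_bracket mu -> lie_bracket (mu + s) ->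
  jacobi_linearized mu s x y z = - (s x (s y z) + s y (s z x) + s z (s x y)).
Proof.
move=> [_ jac] [_ jac']; apply/eqP; rewrite -addr_eq0; apply/eqP.
have addE u v : (mu + s) u v = mu u v + s u v by rewrite !add_lfunE.
have := jac' x y z; rewrite !addE !bilDr => jac2.
have <- : 0 - 0 = 0 :> V by rewrite subrr.
rewrite -[X in _ = X - _]jac2 -[X in _ = _ - X](jac x y z) /jacobi_linearized.
by vring.
Qed.

(** The equation [d1 s = 0] says that s is the tangent vector given by the
    contraction of s, and the homotopy formula bounds [d1 s] by a contraction
    of the quadratic part of the Jacobi identity of mu + s. *)
Theorem semisimple_bracket_rigid (V : vectType R) (mu : 'Hom(V, 'Hom(V, V))) :
  lie_bracket mu -> semisimple mu -> forall delta, 0 < delta ->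
  exists2 eta, 0 < eta & forall nu, lie_bracket nu -> vnorm (nu - mu) < eta ->
    exists2 a : 'End(V), vnorm a < delta &
      forall x y, nu (exp_end a x) (exp_end a y) = exp_end a (mu x y).
Proof.
move=> liemu ssmu delta delta0.
have [m [e [f ef]]] := killing_dual_bases liemu ssmu.
pose h (s : 'Hom(V, 'Hom(V, V))) : 'End(V) := casimir_contraction mu e f s.
have hP : linear h.
  move=> c s t; apply/lfunP => y; rewrite add_lfunE scale_lfunE.
  rewrite !casimir_contractionE scaler_sumr -big_split; apply: eq_bigr => i _.
  by rewrite bracketP linearP.
pose d1 : 'End('Hom(V, 'Hom(V, V))) := linfun (fun s => s + gl_action V (h s) mu).
have d1E s : d1 s = s + gl_action V (h s) mu.
  rewrite linfunE // => c u v; rewrite hP linearP add_lfunE scale_lfunE scalerDr.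
  by rewrite addrACA.
pose q (s t : 'Hom(V, 'Hom(V, V))) x y := \sum_i - mu (e i)
  (s (f i) (t x y) + s x (t y (f i)) + s y (t (f i) x)).
have qr s t x : linear (q s t x).
  move=> c u v; rewrite /q scaler_sumr -big_split; apply: eq_bigr => i _ /=.
  by rewrite !(bilDl, bilZl, bilDr, bilZr); vring.
have ql s t y : linear (fun x => q s t x y).
  move=> c u v; rewrite /q scaler_sumr -big_split; apply: eq_bigr => i _ /=.
  by rewrite !(bilDl, bilZl, bilDr, bilZr); vring.
have [|| C C0 qB] := @bilinear_bounded R _ _ _ (fun s t => bil (q s t)).
- move=> s c t1 t2; apply/lfunP => x; apply/lfunP => y.
  rewrite bracketP !bilE // /q scaler_sumr -big_split; apply: eq_bigr => i _ /=.
  by rewrite !bracketP !(bilDr, bilZr); vring.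
- move=> t c s1 s2; apply/lfunP => x; apply/lfunP => y.
  rewrite bracketP !bilE // /q scaler_sumr -big_split; apply: eq_bigr => i _ /=.
  by rewrite !bracketP !(bilDr, bilZr); vring.
have [|||eta eta0 etaP] := @rigidity R 'End(V) 'Hom(V, 'Hom(V, V)) 'Hom(V, 'Hom(V, V)) (gl_action V) mu
    (@lie_bracket R V) d1 C _ _ _ delta delta0.
- move=> a nu lienu; apply: (lie_bracket_transport (T := exp_end a) (T' := exp_end (- a)) _ _ _ _ lienu).
  + exact: linearP.
  + exact: expKN.
  + exact: expNK.
  + by move=> x y; rewrite -exp_gl_action !expKN.
- move=> s lies; suff -> : d1 s = bil (q s s) by rewrite expr2 mulrA qB.
  rewrite d1E; apply/lfunP => x; apply/lfunP => y; rewrite [RHS]bilE //.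
  have sC u v : s u v = - s v u.
    have := bracketC lies u v; rewrite !add_lfunE (bracketC liemu u v) opprD.
    by move/addrI.
  rewrite add_lfunE [LHS]add_lfunE gl_action_apply [mu (h s x) y](bracketC liemu).
  have := second_whitehead_homotopy liemu ssmu ef x y sC.
  rewrite -/(h s) => /eqP; rewrite -subr_eq0 => /eqP H.
  have -> : q s s x y = \sum_i mu (e i) (jacobi_linearized mu s (f i) x y).
    by apply: eq_bigr => i _; rewrite jacobi_linearizedE // bilNr.
  move: H; set S := \sum_i _ => H.
  apply/eqP; rewrite -subr_eq0 -oppr_eq0 -[X in _ == X]H; apply/eqP; vring.
- move=> s; rewrite d1E => /eqP; rewrite addr_eq0 => /eqP sE; exists (- h s).
  by rewrite linearN opp_lfunE.
exists eta => // nu lienu /(etaP nu lienu)[a ad nuE]; exists a => // x y.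
by rewrite nuE; apply: exp_gl_action.
Qed.

End LocalRigidity.

(** * Rigidity of homomorphisms from a semisimple algebra *)

Section HomomorphismRigidity.
Variables (R : realType) (V g : vectType R).
Variables (mu : 'Hom(V, 'Hom(V, V))) (brg : 'Hom(g, 'Hom(g, g))).
Hypotheses (liemu : lie_bracket mu) (ssmu : semisimple mu) (lieg : lie_bracket brg).
Implicit Types (psi : 'Hom(V, g)) (x y : V).

Definition lie_hom psi := forall x y, psi (mu x y) = brg (psi x) (psi y).

Definition ad_post : 'Hom(g, 'End('Hom(V, g))) :=
  bil (fun u psi => (brg u \o psi)%VF).

Lemma ad_postE u psi : ad_post u psi = (brg u \o psi)%VF.
Proof.
apply: bilE => [v|s] c w z; first by rewrite comp_lfunDr -comp_lfunZr.
by rewrite linearP comp_lfunDl -comp_lfunZl.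
Qed.

Lemma exp_ad_post u psi : exp_end (ad_post u) psi = (exp_end (brg u) \o psi)%VF.
Proof.
apply/lfunP => x; rewrite comp_lfunE.
have evl : linear (fun s : 'Hom(V, g) => s x).
  by move=> c s t; rewrite add_lfunE scale_lfunE.
apply: (exp_intertwine (f := fun s : 'Hom(V, g) => s x) evl) => s.
by rewrite ad_postE comp_lfunE.
Qed.

(** Here [d1] is the differential of 1-cochains with values in g, on which V acts
    through phi. *)
Theorem semisimple_hom_rigid phi : lie_hom phi ->
  exists2 eta, 0 < eta & forall psi, lie_hom psi -> vnorm (psi - phi) < eta ->
    exists u, psi = (exp_end (brg u) \o phi)%VF.
Proof.
move=> homphi.
pose d1f (s : 'Hom(V, g)) x y := s (mu x y) - brg (phi x) (s y) + brg (phi y) (s x).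
have d1r s x : linear (d1f s x).
  move=> c u v; rewrite /d1f !(linearP, bilDl, bilZl) ; vring.
have d1l s y : linear (fun x => d1f s x y).
  move=> c u v; rewrite /d1f !(linearP, bilDl, bilZl); vring.
pose d1 : 'Hom('Hom(V, g), 'Hom(V, 'Hom(V, g))) := linfun (fun s => bil (d1f s)).
have d1E s x y : d1 s x y = d1f s x y.
  rewrite linfunE ?bilE // => c s1 s2; apply/lfunP => u; apply/lfunP => v.
  rewrite (add_lfunE (c *: bil (d1f s1))) scale_lfunE (add_lfunE (c *: bil (d1f s1) u)).
  rewrite scale_lfunE !bilE // /d1f !(add_lfunE, scale_lfunE) !linearP; vring.
have qr (s t : 'Hom(V, g)) x : linear (fun y => brg (s x) (t y)).
  by move=> c u v; rewrite !linearP.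
have ql (s t : 'Hom(V, g)) y : linear (fun x => brg (s x) (t y)).
  by move=> c u v; rewrite linearP bilDl bilZl.
have [|| C C0 qB] := @bilinear_bounded R _ _ _
    (fun s t : 'Hom(V, g) => bil (fun x y => brg (s x) (t y))).
- move=> s c t1 t2; apply/lfunP => x; apply/lfunP => y.
  rewrite (add_lfunE (c *: _)) scale_lfunE (add_lfunE (c *: _)) scale_lfunE.
  by rewrite !bilE ?add_lfunE ?scale_lfunE ?bilDr ?bilZr //.
- move=> t c s1 s2; apply/lfunP => x; apply/lfunP => y.
  rewrite (add_lfunE (c *: _)) scale_lfunE (add_lfunE (c *: _)) scale_lfunE.
  by rewrite !bilE ?add_lfunE ?scale_lfunE ?bilDl ?bilZl //.
have [|||eta eta0 etaP] := @rigidity R g 'Hom(V, g) 'Hom(V, 'Hom(V, g)) ad_post phi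
    lie_hom d1 C _ _ _ 1 ltr01.
- move=> u psi hpsi x y; rewrite exp_ad_post !comp_lfunE hpsi.
  exact: exp_ad_morphism.
- move=> s homs; suff -> : d1 s = bil (fun x y => brg (s x) (s y)) by rewrite expr2 mulrA qB.
  apply/lfunP => x; apply/lfunP => y; rewrite d1E bilE // /d1f.
  have := homs x y; rewrite !add_lfunE homphi !(bilDl, bilDr).
  rewrite [brg (s x) (phi y)](bracketC lieg).
  set A := brg _ _; set B := brg _ _; set C' := brg _ _; set D := brg _ _.
  move=> /eqP; rewrite -subr_eq0 => /eqP H.
  by apply/eqP; rewrite -subr_eq0 -[X in _ == X]H; apply/eqP; vring.
- move=> s ds0.
  pose rho : 'Hom(V, 'End(g)) := (brg \o phi)%VF.
  have rhoP : is_rep mu rho.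
    by move=> x y; rewrite !comp_lfunE homphi; apply: ad_is_rep.
  have [x y|m mE] := @first_whitehead _ _ _ liemu ssmu _ rho s rhoP.
    have := d1E s x y; rewrite ds0 !zero_lfunE /d1f => H; rewrite /rho !comp_lfunE.
    by apply/eqP; rewrite -subr_eq0 [X in _ == X]H; apply/eqP; vring.
  exists (- m); apply/lfunP => x; rewrite ad_postE !comp_lfunE mE comp_lfunE.
  by rewrite (bracketC lieg) bilNl.
exists eta => // psi hpsi /(etaP psi hpsi)[u _ ->]; exists u.
exact: exp_ad_post.
Qed.

End HomomorphismRigidity.

(** * Openness of orbits *)

Section Orbit.
Variables (R : realType) (g : vectType R) (brg : 'Hom(g, 'Hom(g, g))) (n : nat).
Local Notation V := 'rV[R]_n.
Hypothesis lieg : lie_bracket brg.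
Implicit Types (a : 'End(V)) (h : 'End(g)) (p q : pairs n g).

Lemma pairs_eq p q : (forall x y, p.1 x y = q.1 x y) -> (forall x, p.2 x = q.2 x) -> p = q.
Proof.
case: p q => [m1 f1] [m2 f2] /= m12 f12; congr (_, _); last exact/lfunP.
by apply/lfunP => x; apply/lfunP.
Qed.

Lemma GC_act2E a h p x : (GC_act a h p).2 x = h (p.2 ((a^-1)%VF x)).
Proof. by rewrite /= !comp_lfunE. Qed.

Lemma GC_act1E a h p x y :
  (GC_act a h p).1 x y = a (p.1 ((a^-1)%VF x) ((a^-1)%VF y)).
Proof. exact: transportE. Qed.

Lemma GC_act_linear a h : linear (GC_act a h).
Proof.
move=> c p q; apply: pairs_eq => [x y|x].
  have -> : (c *: GC_act a h p + GC_act a h q).1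
    = c *: (GC_act a h p).1 + (GC_act a h q).1 by [].
  by rewrite bracketP !GC_act1E -linearP -bracketP.
have -> : (c *: GC_act a h p + GC_act a h q).2
    = c *: (GC_act a h p).2 + (GC_act a h q).2 by [].
rewrite add_lfunE scale_lfunE !GC_act2E -linearP.
by have -> : (c *: p + q).2 = c *: p.2 + q.2 by [];
  rewrite add_lfunE scale_lfunE.
Qed.

Lemma GC_act_comp a a' h h' p : GL a -> GL a' ->
  GC_act a h (GC_act a' h' p) = GC_act (a \o a')%VF (h \o h')%VF p.
Proof.
move=> aG a'G; have invE x : ((a \o a')^-1)%VF x = (a'^-1)%VF ((a^-1)%VF x).
  apply: (can_inj (GL_K (GL_comp aG a'G))); rewrite (GL_VK (GL_comp aG a'G)).
  by rewrite comp_lfunE (GL_VK a'G) (GL_VK aG).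
apply: pairs_eq => [x y|x]; first by rewrite !GC_act1E !invE comp_lfunE.
by rewrite !GC_act2E !invE comp_lfunE.
Qed.

Lemma GC_act_id p : GC_act (\1)%VF (\1)%VF p = p.
Proof.
have G1 : GL (\1%VF : 'End(V)) by apply: GLP => v; rewrite id_lfunE.
have invE x : (\1^-1)%VF x = x :> V by rewrite -[RHS](GL_K G1) id_lfunE.
by apply: pairs_eq => [x y|x]; rewrite ?GC_act1E ?GC_act2E !invE id_lfunE.
Qed.

Lemma GC_act_L a h p : GL a -> Inn brg h -> L_n brg p -> L_n brg (GC_act a h p).
Proof.
move=> aG /(Inn_automorphism lieg)[_ hb] [liep homp]; split=> [|x y].
  apply: (lie_bracket_transport (T := a) (T' := (a^-1)%VF) _ _ _ _ liep).
  - exact: linearP.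
  - exact: GL_VK.
  - exact: GL_K.
  - by move=> x y; rewrite GC_act1E.
by rewrite !GC_act2E GC_act1E (GL_K aG) homp hb.
Qed.

Lemma local_orbit p : L_n brg p -> semisimple p.1 ->
  exists2 eta, 0 < eta & forall q, L_n brg q -> vnorm (q - p) < eta -> GC_orbit brg p q.
Proof.
move=> [liemu homphi] ssmu.
have [eta2 eta20 homR] := semisimple_hom_rigid liemu ssmu lieg homphi.
have [K K0 compB] : exists2 K : R, 0 < K & forall (f : 'Hom(V, g)) (T : 'End(V)),
    vnorm (f \o T)%VF <= K * vnorm f * vnorm T.
  apply: bilinear_bounded => [S|T] c u v.
    by rewrite comp_lfunDr -comp_lfunZr.
  by rewrite comp_lfunDl -comp_lfunZl.
have [r r0 expP] := @exp_strict_differentiable R V 1 ltr01.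
pose N1 := vnorm (\1%VF : 'End(V)); have N10 : 0 <= N1 by apply: vnorm_ge0.
pose N2 := vnorm p.2; have N20 : 0 <= N2 by apply: vnorm_ge0.
(* With |a| < delta, the part phi o (exp a - 1) of psi - phi costs at most half
   of eta2; the other half is for (phi' - phi) o exp a. *)
pose delta := Num.min r (Num.min 1 (eta2 / (4 * K * (N2 + 1)))).
have D2 : 0 < 4 * K * (N2 + 1) by rewrite !mulr_gt0 // ltr_wpDl.
have delta0 : 0 < delta by rewrite !lt_min r0 ltr01 divr_gt0.
have [eta1 eta10 muR] := semisimple_bracket_rigid liemu ssmu delta0.
have [K1 K10 fstB] := @linear_bounded R (pairs n g) _ (fun q => q.1) (fun c u v => erefl).
have [K2 K20 sndB] := @linear_bounded R (pairs n g) _ (fun q => q.2) (fun c u v => erefl).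
pose c := K * (N1 + 2); have c0 : 0 < c by rewrite mulr_gt0 // ltr_wpDl.
exists (Num.min (eta1 / K1) (eta2 / (2 * c * K2))).
  by rewrite lt_min divr_gt0 //= divr_gt0 // mulr_gt0 // mulr_gt0.
move=> q [lieq homq]; rewrite lt_min => /andP[q1 q2].
have q1' : vnorm (q.1 - p.1) < eta1.
  by rewrite (le_lt_trans (fstB (q - p))) // mulrC -ltr_pdivlMr.
have [a adelta aE] := muR q.1 lieq q1'.
have [ar a1 aeta] : [/\ vnorm a <= r, vnorm a <= 1 & vnorm a * (4 * K * (N2 + 1)) <= eta2].
  by move: adelta; rewrite !lt_min => /and3P[/ltW-> /ltW-> /ltW]; rewrite ler_pdivlMr.
have z0 : vnorm (0 : 'End(V)) <= r by rewrite vnorm0 ltW.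
have expa : vnorm (exp_end a - \1%VF) <= 2 * vnorm a.
  have := expP a 0 ar z0; rewrite exp0 subr0 mul1r => e1.
  rewrite -[exp_end a - _](subrK a) (le_trans (vnormD _ _)) // mulrDl mul1r.
  by rewrite lerD2r.
have expa2 : vnorm (exp_end a) <= N1 + 2.
  rewrite -[exp_end a](subrK \1%VF) (le_trans (vnormD _ _)) // addrC lerD2l.
  by rewrite (le_trans expa) // -[leRHS]mulr1 ler_wpM2l.
pose psi := (q.2 \o exp_end a)%VF.
have hompsi : lie_hom p.1 brg psi.
  by move=> x y; rewrite /psi !comp_lfunE -aE homq.
have [|u psiE] := homR psi hompsi.
  have -> : psi - p.2 = ((q.2 - p.2) \o exp_end a)%VF + (p.2 \o (exp_end a - \1%VF))%VF.
    rewrite comp_lfunDl comp_lfunNl comp_lfunDr comp_lfunNr comp_lfun1r.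
    by rewrite addrA subrK.
  rewrite (le_lt_trans (vnormD _ _)) //.
  have t1 : vnorm ((q.2 - p.2) \o exp_end a)%VF < eta2 / 2.
    rewrite (le_lt_trans (compB _ _)) //.
    apply: (@le_lt_trans _ _ (vnorm (q - p) * (c * K2))).
      rewrite (@le_trans _ _ (K * (K2 * vnorm (q - p)) * (N1 + 2))) //.
        by rewrite ler_pM ?mulr_ge0 ?vnorm_ge0 ?(ltW K0) // ler_wpM2l ?(ltW K0) // (sndB (q - p)).
      by rewrite /c le_eqVlt; apply/orP; left; apply/eqP; ring.
    rewrite -(ltr_pdivlMr _ _ (mulr_gt0 c0 K20)); apply: (lt_le_trans q2).
    rewrite le_eqVlt; apply/orP; left.
    by apply/eqP; field; rewrite !gt_eqF.
  have t2 : vnorm (p.2 \o (exp_end a - \1%VF))%VF <= eta2 / 2.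
    rewrite (le_trans (compB _ _)) //.
    rewrite (@le_trans _ _ (K * N2 * (2 * vnorm a))) //.
      by rewrite ler_wpM2l // mulr_ge0 // ltW.
    rewrite ler_pdivlMr // (le_trans _ aeta) //.
    have -> : K * N2 * (2 * vnorm a) * 2 = vnorm a * (4 * K * N2) by ring.
    by rewrite ler_wpM2l ?vnorm_ge0 // ler_wpM2l ?mulr_ge0 ?(ltW K0) // lerDl.
  by rewrite [ltRHS]splitr ltr_leD.
exists (exp_end a), (exp_end (brg u)); split; [exact: GL_exp|exact: Inn_exp|].
have invE x : ((exp_end a)^-1)%VF x = exp_end (- a) x.
  by apply: (can_inj (GL_K (GL_exp a))); rewrite (GL_VK (GL_exp a)) expKN.
apply: pairs_eq => [x y|x].
  by rewrite GC_act1E !invE -aE !expKN.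
rewrite GC_act2E invE; have /lfunP/(_ (exp_end (- a) x)) := psiE.
by rewrite /psi !comp_lfunE expKN.
Qed.

End Orbit.

Theorem theorem1p2 (R : realType) (g : vectType R)
    (brg : 'Hom(g, 'Hom(g, g))) (n : nat)
    (mu : 'Hom('rV[R]_n, 'Hom('rV[R]_n, 'rV[R]_n))) (phi : 'Hom('rV[R]_n, g)) :
  lie_bracket brg -> semisimple brg ->
  (1 <= n)%N ->
  L_n brg (mu, phi) -> semisimple mu ->
  open_in (L_n brg) (GC_orbit brg (mu, phi)).
Proof.
move=> lieg _ _ Lp ssmu; set p : pairs n g := (mu, phi).
have [eta eta0 locp] := local_orbit lieg Lp ssmu.
pose near_orbit (x : pairs n g) (c : R) :=
  forall q, L_n brg q -> vnorm (q - x) < c -> GC_orbit brg p q.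
exists (\bigcup_(xc in [set xc : pairs n g * R | near_orbit xc.1 xc.2])
   [set y : euclidean (pairs n g) | vnorm (y - xc.1 : pairs n g) < xc.2]).
  by apply: bigcup_open => xc _; apply: euclidean_ball_open.
apply/seteqP; split=> [q0 [a [h [aG hI ->]]]|q [Lq [[x c] /= xc qx]]]; last first.
  exact: xc.
split; first exact: GC_act_L.
have [hG _] := Inn_automorphism lieg hI.
have [K K0 KB] := linear_bounded (GC_act_linear (a^-1)%VF (h^-1)%VF).
(* The ball around (a, h).p that (a, h)^-1 maps into the ball around p. *)
exists (GC_act a h p, eta / K) => /=; last by rewrite subrr vnorm0 divr_gt0.
have act_id q : GC_act a h (GC_act (a^-1)%VF (h^-1)%VF q) = q.
  rewrite GC_act_comp //; last exact: GL_inv.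
  by rewrite !lker0_compfV // GC_act_id.
have act_idV q : GC_act (a^-1)%VF (h^-1)%VF (GC_act a h q) = q.
  rewrite GC_act_comp //; last exact: GL_inv.
  by rewrite !lker0_compVf // GC_act_id.
move=> q Lq qx; pose q' := GC_act (a^-1)%VF (h^-1)%VF q.
have Lq' : L_n brg q'.
  by apply: GC_act_L => //; [exact: GL_inv|exact: Inn_inv].
have [|a' [h' [a'G h'I q'E]]] := locp q' Lq'.
  have -> : q' - p = GC_act (a^-1)%VF (h^-1)%VF (q - GC_act a h p).
    by rewrite (linear_funB (GC_act_linear _ _)) act_idV.
  by rewrite (le_lt_trans (KB _)) // mulrC -ltr_pdivlMr.
exists (a \o a')%VF, (h \o h')%VF; split; [exact: GL_comp|exact: Inn_comp|].
by rewrite -(act_id q) -/q' q'E GC_act_comp.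
Qed.
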